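(* For any graphs $G$ and $H$, $$\Sigma \mathcal{F}_0(G\circ H)\simeq\bigvee_{\sigma\in \mathcal{F}_0(G)}\Sigma\left(\mathcal{F}_0\Big(G-\bigcup_{v\in\sigma}N[v]\Big)*\mathcal{F}_0(H)^{*|\sigma|}\right).$$
   Context: Graphs are finite and simple, with non-empty vertex set ($G-S$ may be the empty graph). $N[v]$ is the closed neighborhood of $v$ in $G$. $\mathcal{F}_0(G)$ is the independence complex of $G$: its simplices are the independent sets of vertices, including the empty set (so the wedge includes $\sigma=\emptyset$). For the empty graph, $\mathcal{F}_0=\{\emptyset\}$, whose realization is the empty space. The lexicographic product $G\circ H$ has vertex set $V(G)\times V(H)$ and edges $\{(u,v_1),(u,v_2)\}$ for $\{v_1,v_2\}\in E(H)$ and $\{(u_1,v_1),(u_2,v_2)\}$ for $\{u_1,u_2\}\in E(G)$. $*$ is the join with $Y*\emptyset=Y$; $X^{*k}$ is the join of $k$ copies of $X$, $X^{*0}=\emptyset$; $\Sigma$ is the unreduced suspension, $\Sigma\emptyset=\mathbb{S}^0$. *)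

(* Defs.v *)
From HB Require Import structures.
From mathcomp Require Import all_boot all_order all_algebra.
From mathcomp Require Import generic_quotient.
From mathcomp Require Import all_classical all_reals topology normedtype.
From mathcomp Require Import wedge_sigT.

Set Implicit Arguments.
Unset Strict Implicit.
Unset Printing Implicit Defensive.

Import Order.TTheory GRing.Theory Num.Theory.
Import numFieldNormedType.Exports.

Local Open Scope ring_scope.

(* The vertex type may be empty, so that deletions are always graphs; the
   theorem assumes non-emptiness where it is required. *)
Record sgraph := SGraph {
  vertex :> finType;
  edge : rel vertex;
  edge_sym : symmetric edge;
  edge_irr : irreflexive edge }.

Section lexicographic_product.
Variables G H : sgraph.

Definition lex_rel (x y : G * H) :=
  (x.1 == y.1) && edge x.2 y.2 || edge x.1 y.1.

Lemma lex_rel_sym : symmetric lex_rel.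
Proof.
by move=> x y; rewrite /lex_rel eq_sym (edge_sym x.2) (edge_sym x.1).
Qed.

Lemma lex_rel_irr : irreflexive lex_rel.
Proof. by move=> x; rewrite /lex_rel !edge_irr andbF. Qed.

Definition lex_prod := SGraph lex_rel_sym lex_rel_irr.

End lexicographic_product.

Section deletion.
Variables (G : sgraph) (S : {set G}).

Definition del_rel : rel {v : G | v \notin S} :=
  fun x y => edge (val x) (val y).

Lemma del_rel_sym : symmetric del_rel.
Proof. by move=> x y; rewrite /del_rel edge_sym. Qed.

Lemma del_rel_irr : irreflexive del_rel.
Proof. by move=> x; rewrite /del_rel edge_irr. Qed.

Definition del_vertices := SGraph del_rel_sym del_rel_irr.

End deletion.

Definition closed_nbhd (G : sgraph) (v : G) : {set G} :=
  [set u | (u == v) || edge v u]%SET.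

Definition indep_complex (G : sgraph) : {set {set G}} :=
  [set A : {set G} | [forall x in A, forall y in A, ~~ edge x y]]%SET.

Lemma indep_complex0 (G : sgraph) : finset.set0 \in indep_complex G.
Proof. by rewrite inE; apply/forall_inP => x; rewrite inE. Qed.

Lemma indep_complexS (G : sgraph) (A B : {set G}) :
  A \subset B -> B \in indep_complex G -> A \in indep_complex G.
Proof.
move=> /fintype.subsetP AB; rewrite !inE => /forall_inP iB.
apply/forall_inP => x Ax; apply/forall_inP => y Ay.
by have /forall_inP := iB x (AB x Ax); apply; apply: AB.
Qed.

HB.instance Definition _ := hasNbhs.Build unit principal_filter.
HB.instance Definition _ := Discrete_ofNbhs.Build unit erefl.
HB.instance Definition _ := hasNbhs.Build void principal_filter.
HB.instance Definition _ := Discrete_ofNbhs.Build void erefl.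

Local Open Scope classical_set_scope.
Local Open Scope quotient_scope.

Definition unit_interval (R : realType) : topologicalType :=
  set_type (`[0, 1] : set R).

(* Barycentric coordinates: a point is a convex combination of vertices whose
   support is a simplex. The complex {set0} has an empty realization. *)
Definition realization (R : realType) (V : finType) (K : {set {set V}}) :
    topologicalType :=
  set_type [set x : prod_topology (fun _ : V => R) |
    [/\ forall v, 0 <= x v,
        \sum_v x v = 1 &
        [set v | x v != 0]%SET \in K]].

Definition homotopic (R : realType) (X Y : topologicalType) (f g : X -> Y) :=
  exists h : X * unit_interval R -> Y,
    [/\ continuous h,
        forall x t, \val t = 0 -> h (x, t) = f x &
        forall x t, \val t = 1 -> h (x, t) = g x].

Definition homotopy_equivalent (R : realType) (X Y : topologicalType) :=
  exists f : X -> Y, exists g : Y -> X,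
    [/\ continuous f, continuous g,
        homotopic R (g \o f) id & homotopic R (f \o g) id].

(* The double mapping cylinder (homotopy pushout) of X <-f- Z -g-> Y: the
   quotient of the disjoint union of X (index Some false), Z * [0, 1] (index
   None) and Y (index Some true) that identifies (z, 0) with f z and (z, 1)
   with g z. *)
Section double_cylinder.
Variables (R : realType) (X Y Z : topologicalType) (f : Z -> X) (g : Z -> Y).

Definition cyl_part (i : option bool) : topologicalType :=
  match i with
  | None => (Z * unit_interval R)%type
  | Some false => X
  | Some true => Y
  end.

Definition cyl_sum := {i & cyl_part i}.

Definition cyl_left (x : X) : cyl_sum := existT cyl_part (Some false) x.
Definition cyl_right (y : Y) : cyl_sum := existT cyl_part (Some true) y.

(* Two points are identified exactly when they have the same normal form. *)
Definition cyl_nf (p : cyl_sum) : cyl_sum :=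
  match p with
  | existT None zt =>
      if \val zt.2 == 0 then cyl_left (f zt.1)
      else if \val zt.2 == 1 then cyl_right (g zt.1)
      else p
  | _ => p
  end.

Definition cyl_eqb : rel cyl_sum := fun p q => cyl_nf p == cyl_nf q.

Lemma cyl_rel_refl : reflexive cyl_eqb.
Proof. by move=> p; apply: eqxx. Qed.

Lemma cyl_rel_sym : symmetric cyl_eqb.
Proof. by move=> p q; apply: eq_sym. Qed.

Lemma cyl_rel_trans : transitive cyl_eqb.
Proof. by move=> q p r /eqP pq /eqP qr; apply/eqP; rewrite pq. Qed.

Definition cyl_rel := EquivRel _ cyl_rel_refl cyl_rel_sym cyl_rel_trans.

Definition double_cylinder : topologicalType :=
  quotient_topology {eq_quot cyl_rel}.

Definition cyl_pi (p : cyl_sum) : double_cylinder :=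
  \pi_{eq_quot cyl_rel} p.

End double_cylinder.

(* The join X * Y; it reduces to X when Y is empty, and to Y when X is. *)
Definition join (R : realType) (X Y : topologicalType) : topologicalType :=
  @double_cylinder R X Y (X * Y)%type fst snd.

Fixpoint join_power (R : realType) (X : topologicalType) (k : nat) :
    topologicalType :=
  if k is k'.+1 then join R X (join_power R X k') else void.

(* The unreduced suspension; the two cone points remain distinct when X is
   empty, so that the suspension of the empty space is a two-point space. *)
Definition suspension (R : realType) (X : topologicalType) : topologicalType :=
  @double_cylinder R unit unit X (fun=> tt) (fun=> tt).

(* The base point of a suspension. A suspension is path connected, or a
   two-point space whose points are exchanged by a symmetry, so choosing another
   base point does not change the homotopy type of a wedge of suspensions of
   finite complexes. *)
Definition south_pole (R : realType) (X : topologicalType) : suspension R X :=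
  cyl_pi _ _ (@cyl_left R unit unit X tt).

(* Main.v *)
Require Import Defs.
From HB Require Import structures.
From mathcomp Require Import all_boot all_order all_algebra.
From mathcomp Require Import generic_quotient.
From mathcomp Require Import all_classical all_reals topology normedtype.
From mathcomp Require Import wedge_sigT.
From mathcomp Require Import lra.

(** Both sides are realizations of finite simplicial complexes, and a chain of
    collapses and expansions leads from one complex to the other.

    Let X be the independence complex of the lexicographic product, K that of
    G, and x0 a vertex of H. A set of vertices of the product is a simplex of X
    exactly when its projection to G is independent and each of its fibres is
    independent in H. For sigma in K let X_sigma consist of the simplices A of X
    such that the union of sigma and the projection of A is in K, and whose
    fibres outside sigma contain at most x0. Outside sigma such a simplex is an
    independent set of G - N[sigma], over sigma it is a choice of one simplex of
    F_0(H) for each vertex, so X_sigma is the join on the right-hand side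
    ([link_join], [power_embedding], [link_embedding]). The claim becomes that
    the suspension of X is the wedge of the suspensions of the X_sigma.

    Now X is glued from the X_sigma along cones. For a set T of vertices of G,
    let X(T, sigma) be defined like X_sigma, but with arbitrary fibres over T as
    well ([partial_link]). If v is in T and not in sigma, then X(T, sigma) is
    the union of X(T - v, sigma) and X(T - v, sigma + v), and the intersection
    of these two is a cone with apex (v, x0): over v it has no vertex other than
    (v, x0), and v can be added to all the projections. A [fan] has a cone over
    X with apex south, and further cones with distinct apexes over subcomplexes
    of X. The suspension of X is a fan with one further cone ([suspension_fan]).
    A cone over a union of two complexes that meet in a cone can be replaced by
    the two cones over these complexes ([fan_split]): the two cones, joined
    along the intersection, differ from their separate union by the open star of
    an edge whose link is a cone. Splitting along all vertices v gives a fan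
    with one cone over each X_sigma ([stages]). Since the cone over X
    contracts to its apex, this fan is equivalent to the wedge of the
    suspensions of the X_sigma ([fan_bouquet]).

    All these equivalences come from one move ([remove_star_equiv]): if each
    simplex of a complex that contains tau can be extended by a vertex c outside
    tau, then the open star of tau can be removed, because mass can be pushed
    along straight lines from the vertices of tau onto c. The double mapping
    cylinders and the wedge in the statement are identified with realizations by
    continuous bijections from compact spaces to Hausdorff ones
    ([embedding_equiv], [embedding_join], [embedding_suspension],
    [embedding_wedge]). *)

Set Implicit Arguments.
Unset Strict Implicit.
Unset Printing Implicit Defensive.

Import Order.TTheory GRing.Theory Num.Theory.
Import numFieldNormedType.Exports.

Local Open Scope ring_scope.
Local Open Scope classical_set_scope.

(** * Continuity *)

Section continuity.
Context {R : realType} {X : topologicalType}.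
Implicit Types f g : X -> R.

Lemma ctsD f g : continuous f -> continuous g -> continuous (fun x => f x + g x).
Proof. by move=> cf cg x; apply: cvgD; [exact: cf|exact: cg]. Qed.

Lemma ctsB f g : continuous f -> continuous g -> continuous (fun x => f x - g x).
Proof. by move=> cf cg x; apply: cvgB; [exact: cf|exact: cg]. Qed.

Lemma ctsM f g : continuous f -> continuous g -> continuous (fun x => f x * g x).
Proof. by move=> cf cg x; apply: cvgM; [exact: cf|exact: cg]. Qed.

Lemma cts_min f g :
  continuous f -> continuous g -> continuous (fun x => Num.min (f x) (g x)).
Proof. by move=> cf cg x; apply: continuous_min; [exact: cf|exact: cg]. Qed.

Lemma cts_max f g :
  continuous f -> continuous g -> continuous (fun x => Num.max (f x) (g x)).
Proof. by move=> cf cg x; apply: continuous_max; [exact: cf|exact: cg]. Qed.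

Lemma cts_cst (r : R) : continuous (fun _ : X => r).
Proof. by move=> x; exact: cvg_cst. Qed.

Lemma cts_sum (I : Type) (s : seq I) (P : pred I) (F : I -> X -> R) :
  (forall i, continuous (F i)) ->
  continuous (fun x => \sum_(i <- s | P i) F i x).
Proof.
move=> cF; elim: s => [|i s IHs].
  by under eq_fun do rewrite big_nil; exact: cts_cst.
under eq_fun do rewrite big_cons.
case: (P i) => //; exact: ctsD.
Qed.

Lemma cts_bigmin (I : Type) (s : seq I) (P : pred I) (r : R) (F : I -> X -> R) :
  (forall i, continuous (F i)) ->
  continuous (fun x => \big[Num.min/r]_(i <- s | P i) F i x).
Proof.
move=> cF; elim: s => [|i s IHs].
  by under eq_fun do rewrite big_nil; exact: cts_cst.
under eq_fun do rewrite big_cons.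
case: (P i) => //; exact: cts_min.
Qed.

End continuity.

Lemma cts_pair (X Y Z : topologicalType) (f : X -> Y) (g : X -> Z) :
  continuous f -> continuous g -> continuous (fun x => (f x, g x)).
Proof. by move=> cf cg x; apply: cvg_pair; [exact: cf|exact: cg]. Qed.

Lemma cts_comp (X Y Z : topologicalType) (f : X -> Y) (g : Y -> Z) :
  continuous f -> continuous g -> continuous (g \o f).
Proof. by move=> cf cg x; apply: continuous_comp; [exact: cf|exact: cg]. Qed.

Lemma cts_fst (X Y : topologicalType) : continuous (@fst X Y).
Proof. by move=> x; exact: cvg_fst. Qed.

Lemma cts_snd (X Y : topologicalType) : continuous (@snd X Y).
Proof. by move=> x; exact: cvg_snd. Qed.

Lemma cts_val (X : topologicalType) (A : set X) :
  continuous (fun z : set_type A => \val z).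
Proof. exact: initial_continuous. Qed.

Definition sub_pt (X : Type) (A : set X) (x : X) (Ax : A x) : set_type A :=
  exist _ x (mem_set Ax).

Lemma cts_into_sub (X Y : topologicalType) (A : set X) (f : Y -> set_type A) :
  continuous (fun y => \val (f y)) -> continuous f.
Proof. by move=> cf; apply: continuous_comp_initial. Qed.

Lemma cts_coord (R : realType) (V : finType) (v : V) :
  continuous (fun x : prod_topology (fun _ : V => (R : topologicalType)) => (x v : R)).
Proof. exact: (@proj_continuous _ (fun _ : V => R : topologicalType) v). Qed.

Lemma cts_into_prod (R : realType) (V : finType) (X : topologicalType)
    (f : X -> prod_topology (fun _ : V => (R : topologicalType))) :
  (forall v, continuous (fun x => (f x v : R))) -> continuous f.
Proof.
move=> cf x; apply/cvg_sup => v.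
exact: (@continuous_comp_initial _ _ _ (fun g : V -> R => g v) f (cf v)).
Qed.

(** * Homotopies *)

Section clamp.
Variable R : realType.

Lemma clamp_subproof (r : R) :
  `[0, 1]%classic (Num.max 0 (Num.min 1 r)).
Proof. by rewrite /= in_itv /=; rewrite le_max lexx /= ge_max ler01 ge_min lexx. Qed.

(** Retracts the line onto the unit interval, so that reparametrizations of a
    homotopy are total and continuous on the whole cylinder. *)
Definition clamp (r : R) : unit_interval R :=
  sub_pt (clamp_subproof r).

Lemma cts_clamp : continuous clamp.
Proof.
apply: cts_into_sub; apply: cts_max; first exact: cts_cst.
by apply: cts_min; [exact: cts_cst|move=> x; exact: cvg_id].
Qed.

Lemma unit_interval_bounds (t : unit_interval R) : 0 <= \val t <= 1.
Proof. by case: t => t /= /set_mem; rewrite /= in_itv. Qed.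

Lemma clampE (r : R) : 0 <= r <= 1 -> \val (clamp r) = r.
Proof. by case/andP=> r0 r1 /=; rewrite (min_r r1) (max_r r0). Qed.

Lemma val_clamp0 : \val (clamp 0) = 0.
Proof. by rewrite clampE // lexx ler01. Qed.

Lemma val_clamp1 : \val (clamp 1) = 1.
Proof. by rewrite clampE // lexx ler01. Qed.
End clamp.

Section homotopy.
Variable R : realType.

Lemma homotopic_refl (X Y : topologicalType) (f : X -> Y) :
  continuous f -> homotopic R f f.
Proof.
move=> cf; exists (f \o fst); split => //.
by apply: cts_comp => //; exact: cts_fst.
Qed.

Lemma homotopic_trans (X Y : topologicalType) (f g k : X -> Y) :
  homotopic R f g -> homotopic R g k -> homotopic R f k.
Proof.
move=> [h1 [c1 h10 h11]] [h2 [c2 h20 h21]].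
have cval : continuous (fun p : X * unit_interval R => \val p.2 : R).
  by apply: (@cts_comp _ _ _ snd); [exact: cts_snd|exact: cts_val].
pose g1 (p : X * unit_interval R) := h1 (p.1, clamp (\val p.2 + \val p.2)).
pose g2 (p : X * unit_interval R) := h2 (p.1, clamp (\val p.2 + \val p.2 - 1)).
have cg1 : continuous g1.
  apply: (@cts_comp _ _ _ _ h1) => //; apply: cts_pair; first exact: cts_fst.
  by apply: (@cts_comp _ _ _ _ (@clamp R)); [exact: ctsD|exact: cts_clamp].
have cg2 : continuous g2.
  apply: (@cts_comp _ _ _ _ h2) => //; apply: cts_pair; first exact: cts_fst.
  apply: (@cts_comp _ _ _ _ (@clamp R)); last exact: cts_clamp.
  by apply: ctsB; [exact: ctsD|exact: cts_cst].
pose A := [set p : X * unit_interval R | \val p.2 + \val p.2 <= 1 :> R].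
pose B := [set p : X * unit_interval R | 1 <= \val p.2 + \val p.2 :> R].
pose h p := if (\val p.2 + \val p.2 <= 1 :> R) then g1 p else g2 p.
have cd := ctsD cval cval.
exists h; split.
- have AB : A `|` B = setT.
    rewrite -subTset => p _; rewrite /A /B /=.
    by case: (leP (\val p.2 + \val p.2) 1) => [|/ltW]; [left|right].
  apply/continuous_subspace_setT; rewrite -AB; apply: withinU_continuous.
  + by apply: (closed_comp (f := fun p : X * unit_interval R =>
      \val p.2 + \val p.2 : R) (D := [set r : R | r <= 1])) => [p _|]; [exact: cd|exact: closed_le].
  + by apply: (closed_comp (f := fun p : X * unit_interval R =>
      \val p.2 + \val p.2 : R) (D := [set r : R | 1 <= r])) => [p _|]; [exact: cd|exact: closed_ge].
  + apply: (@subspace_eq_continuous _ _ _ g1); last exact: continuous_subspaceT.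
    by move=> p /set_mem Ap; change (g1 p = h p); rewrite /h ifT.
  + apply: (@subspace_eq_continuous _ _ _ g2); last exact: continuous_subspaceT.
    move=> p /set_mem; rewrite /B /= => Bp.
    change (g2 p = h p); rewrite /h; case: ifP => // Ap.
    have e : \val p.2 + \val p.2 = 1 :> R by apply/eqP; rewrite eq_le Ap.
    by rewrite /g1 /g2 e subrr h11 ?val_clamp1 // h20 ?val_clamp0.
- move=> x t t0; rewrite /h /= t0 addr0 ler01 /g1 /= t0 addr0.
  by rewrite h10 ?val_clamp0.
- move=> x t t1; rewrite /h /= t1; case: ifP => [c|]; first by exfalso; lra.
  by move=> _; rewrite /g2 /= t1 addrK h21 ?val_clamp1.
Qed.

Lemma homotopic_compl (X Y Z : topologicalType) (f g : X -> Y) (k : Y -> Z) :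
  continuous k -> homotopic R f g -> homotopic R (k \o f) (k \o g).
Proof.
move=> ck [h [ch h0 h1]]; exists (k \o h); split; first exact: cts_comp.
- by move=> x t t0 /=; rewrite h0.
- by move=> x t t1 /=; rewrite h1.
Qed.

Lemma homotopic_compr (X Y Z : topologicalType) (f g : Y -> Z) (k : X -> Y) :
  continuous k -> homotopic R f g -> homotopic R (f \o k) (g \o k).
Proof.
move=> ck [h [ch h0 h1]]; exists (fun p => h (k p.1, p.2)); split.
- apply: (@cts_comp _ _ _ _ h) => //; apply: cts_pair; last exact: cts_snd.
  by apply: cts_comp => //; exact: cts_fst.
- by move=> x t t0 /=; rewrite h0.
- by move=> x t t1 /=; rewrite h1.
Qed.

Lemma homotopy_equivalent_refl (X : topologicalType) : homotopy_equivalent R X X.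
Proof.
have cid : continuous (@id X) by move=> x; exact: cvg_id.
by exists id, id; split => //; exact: homotopic_refl.
Qed.

Lemma homotopy_equivalent_sym (X Y : topologicalType) :
  homotopy_equivalent R X Y -> homotopy_equivalent R Y X.
Proof. by move=> [f [g [cf cg gf fg]]]; exists g, f. Qed.

Lemma homotopy_equivalent_trans (X Y Z : topologicalType) :
  homotopy_equivalent R X Y -> homotopy_equivalent R Y Z ->
  homotopy_equivalent R X Z.
Proof.
move=> [f [g [cf cg gf fg]]] [f' [g' [cf' cg' gf' fg']]].
exists (f' \o f), (g \o g'); split; [exact: cts_comp|exact: cts_comp| |].
- apply: homotopic_trans gf.
  exact: (homotopic_compl cg (homotopic_compr cf gf')).
- apply: homotopic_trans fg'.
  exact: (homotopic_compl cf' (homotopic_compr cg' fg)).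
Qed.

End homotopy.

(** * Realizations of simplicial complexes *)

Definition complex (V : finType) (K : {set {set V}}) : Prop :=
  forall A B : {set V}, A \subset B -> B \in K -> A \in K.

Definition coords (R : realType) (V : finType) : topologicalType :=
  prod_topology (fun _ : V => R).

Definition geom (R : realType) (V : finType) (K : {set {set V}}) :
    set (coords R V) :=
  [set x : prod_topology (fun _ : V => R) |
    [/\ forall v, 0 <= x v, \sum_v x v = 1 & [set v | x v != 0]%SET \in K]].

Lemma compact_set_type (X : topologicalType) (A : set X) :
  compact A -> compact [set: set_type A].
Proof.
move=> cA F FF _.
pose G : set_system X := (fun z : set_type A => \val z) @ F.
have GP : ProperFilter G by exact: fmap_proper_filter.
have GA : G A.
  have FT : F setT by exact: filterT.
  by apply: (@filterS _ F _ _ _ _ FT) => z _; exact: set_mem (valP z).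
have [p [Ap clp]] := cA G GP GA.
exists (sub_pt Ap); split => // U W FU [_ [[O oO <-] /= Op] OW].
have [||z [[y Uy <-] Oy]] := clp (set_val @` U) O.
- by apply: (@filterS _ F _ _ _ _ FU) => y Uy; exists y.
- exact: open_nbhs_nbhs.
by exists y; split => //; exact: OW.
Qed.

Section realization.
Variables (R : realType) (V : finType).
Implicit Types (K : {set {set V}}) (x y : coords R V).

Lemma geom_sub K (C : {set V}) x : complex K -> C \in K ->
  (forall v, 0 <= x v) -> \sum_v x v = 1 -> (forall v, v \notin C -> x v = 0) ->
  geom K x.
Proof.
move=> cK CK x0 x1 xC; split => //; apply: cK CK.
apply/fintype.subsetP => v; rewrite inE; apply: contraNT => /xC ->.
by rewrite eqxx.
Qed.

Lemma geom_le1 K x v : geom K x -> x v <= 1.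
Proof.
move=> [x0 <- _]; rewrite (bigD1 v) //= lerDl.
by apply: sumr_ge0 => w _; exact: x0.
Qed.

Lemma geom_supp K x : geom K x ->
  exists2 C, C \in K & forall v, v \notin C -> x v = 0.
Proof.
move=> [_ _ xK]; eexists; first exact: xK.
by move=> v; rewrite inE negbK => /eqP.
Qed.

(** The segment between two points of a common closed simplex stays in that
    simplex, so the linear interpolation is a homotopy in the realization. *)
Lemma straight_homotopy K (X : topologicalType) (f g : X -> realization R K) :
  complex K -> continuous f -> continuous g ->
  (forall z, exists2 C, C \in K &
     forall v, v \notin C -> \val (f z) v = 0 /\ \val (g z) v = 0) ->
  homotopic R f g.
Proof.
move=> cK cf cg fgC.
pose L (p : X * unit_interval R) : coords R V := fun v =>
  (1 - \val p.2) * \val (f p.1) v + \val p.2 * \val (g p.1) v.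
have gL p : geom K (L p).
  case: p => x t; have [C CK fgx] := fgC x.
  have /andP[t0 t1] := unit_interval_bounds t.
  have [f0 f1 _] : geom K (\val (f x)) by exact: set_mem (valP (f x)).
  have [g0 g1 _] : geom K (\val (g x)) by exact: set_mem (valP (g x)).
  apply: (geom_sub cK CK).
  - by move=> v; rewrite /L /= addr_ge0 ?mulr_ge0 ?subr_ge0 ?f0 ?g0.
  - by rewrite /L big_split /= -!mulr_sumr f1 g1; lra.
  - by move=> v /fgx[fv gv]; rewrite /L /= fv gv !mulr0 addr0.
exists (fun p => sub_pt (gL p) : realization R K); split.
- apply: cts_into_sub; apply: cts_into_prod => v.
  have ct : continuous (fun p : X * unit_interval R => \val p.2 : R).
    by apply: (@cts_comp _ _ _ snd); [exact: cts_snd|exact: cts_val].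
  have co (h : X -> realization R K) : continuous h ->
      continuous (fun p : X * unit_interval R => \val (h p.1) v : R).
    move=> ch; apply: (@cts_comp _ _ _ (fun p => \val (h p.1)) (fun y : coords R V => y v)).
      apply: (@cts_comp _ _ _ (h \o fst)); last exact: cts_val.
      by apply: cts_comp => //; exact: cts_fst.
    exact: cts_coord.
  apply: ctsD; apply: ctsM => //; try exact: co.
  by apply: ctsB => //; exact: cts_cst.
- move=> x t t0; apply: val_inj => /=; apply/funext => v.
  by rewrite /L /= t0 subr0 mul1r mul0r addr0.
- move=> x t t1; apply: val_inj => /=; apply/funext => v.
  by rewrite /L /= t1 subrr mul1r mul0r add0r.
Qed.

(** For a family closed under subsets the realization is the union of finitely
    many closed faces of a cube; for other families it may fail to be closed. *)
Lemma compact_realization K : complex K -> compact [set: realization R K].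
Proof.
move=> cK.
have cgeom : compact (geom K : set (coords R V)).
  pose cube : set (coords R V) := [set x : forall _ : V, R | forall v, `[0, 1]%classic (x v)].
  have ccube : compact cube by exact: (@tychonoff V (fun _ => R : topologicalType)
      (fun _ => `[0, 1]%classic) (fun _ => @segment_compact R 0 1)).
  pose face (C : {set V}) : set (coords R V) :=
    [set x | \sum_v x v = 1] `&` \bigcap_v [set x | 0 <= x v] `&`
    \bigcap_(v in [set v | v \notin C]) [set x | x v = 0].
  have -> : geom K = cube `&` \bigcup_(C in [set C | C \in K]) face C.
    rewrite eqEsubset; split => x.
      move=> gx; have [x0 x1 xK] := gx; split.
        by move=> v /=; rewrite in_itv /= x0 (geom_le1 _ gx).
      exists [set v | x v != 0]%SET => //; split.
        by split=> // v _; exact: x0.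
      by move=> v /=; rewrite inE negbK => /eqP.
    move=> [_ [C CK [[x1 x0] xC]]].
    by apply: (geom_sub cK CK) => // v; exact: x0.
  have csum : continuous (fun x : coords R V => \sum_v x v : R).
    exact: (@cts_sum _ _ _ _ _ (fun v (x : coords R V) => x v) (@cts_coord R V)).
  apply: compact_closedI => //; apply: closed_bigcup => //.
  move=> C _; apply: closedI; first apply: closedI.
  - apply: (closed_comp (f := fun x : coords R V => \sum_v x v : R) (D := [set 1])).
      by move=> x _; exact: csum.
    exact: closed_eq.
  - apply: closed_bigI => v _.
    apply: (closed_comp (f := fun x : coords R V => x v : R) (D := [set r | 0 <= r])).
      by move=> x _; exact: cts_coord.
    exact: closed_ge.
  - apply: closed_bigI => v _.
    apply: (closed_comp (f := fun x : coords R V => x v : R) (D := [set 0])).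
      by move=> x _; exact: cts_coord.
    exact: closed_eq.
exact: compact_set_type.
Qed.

End realization.

Lemma cts_eval (R : realType) (V : finType) (X : topologicalType)
    (f : X -> coords R V) (v : V) :
  continuous f -> continuous (fun x => f x v : R).
Proof.
by move=> cf; apply: (@cts_comp _ _ _ f (fun x => x v)) => //; exact: cts_coord.
Qed.

(** * Collapses *)

Section collapse.
Variables (R : realType) (V : finType).
Implicit Types (K : {set {set V}}) (tau : {set V}) (c v : V).

Definition remove_star K tau : {set {set V}} :=
  [set A in K | ~~ (tau \subset A)]%SET.

(** Coordinates of a point of a realization are at most 1, so the start value 1
    does not affect the minimum over a non-empty set. *)
Definition min_coord tau (x : coords R V) : R := \big[Num.min/1]_(v in tau) x v.

(** Takes the same mass off all the vertices of [tau], as much as possible, and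
    gives it to [c]. *)
Definition push tau c (x : coords R V) : coords R V := fun v =>
  x v - (v \in tau)%:R * min_coord tau x
      + (v == c)%:R * (#|tau|%:R * min_coord tau x).

Lemma min_coord_le tau x v : v \in tau -> min_coord tau x <= x v.
Proof. by move=> tv; rewrite /min_coord (bigD1 v) //= ge_min lexx. Qed.

Lemma min_coord_ge0 tau x : (forall v, 0 <= x v) -> 0 <= min_coord tau x.
Proof.
move=> x0; rewrite /min_coord; apply: (big_ind (fun r => 0 <= r)) => //.
by move=> r s r0 s0; rewrite le_min r0.
Qed.

Lemma min_coord_attained K tau x : geom K x -> tau != finset.set0 ->
  exists2 v, v \in tau & min_coord tau x = x v.
Proof.
move=> gx /set0Pn[w tw].
case: (@Order.TotalTheory.arg_minP _ R V w (mem tau) x tw) => v tv vP.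
exists v => //; apply/eqP; rewrite eq_le min_coord_le //=.
rewrite /min_coord; apply: (big_ind (fun r => x v <= r)) => //; first exact: geom_le1 _ gx.
by move=> r s rv sv; rewrite le_min rv.
Qed.

Lemma min_coord_eq0 K tau x : geom K x -> tau != finset.set0 ->
  ~~ (tau \subset [set v | x v != 0]%SET) -> min_coord tau x = 0.
Proof.
move=> gx t0 /subsetPn[v tv]; rewrite inE negbK => /eqP xv.
have [x0 _ _] := gx; apply/eqP; rewrite eq_le min_coord_ge0 // andbT.
by rewrite -xv min_coord_le.
Qed.

Lemma cts_push tau c (X : topologicalType) (f : X -> coords R V) :
  (forall v, continuous (fun z => f z v : R)) ->
  forall v, continuous (fun z => push tau c (f z) v : R).
Proof.
move=> cf v.
have cm : continuous (fun z => min_coord tau (f z)).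
  exact: (@cts_bigmin _ _ _ _ _ _ (fun v z => f z v)).
apply: ctsD; first apply: ctsB => //.
  by apply: ctsM => //; exact: cts_cst.
by apply: ctsM; [exact: cts_cst|apply: ctsM => //; exact: cts_cst].
Qed.

(** Pushing mass from [tau] onto [c] brings at least one coordinate in [tau] to
    zero, so it retracts the realization onto the complement of the open star
    of [tau]; it fixes this complement, where the minimum over [tau] is 0. The
    vertices that occur before and after the push lie in a common simplex
    extended by [c], hence a straight homotopy to the identity. *)
Lemma remove_star_equiv K tau c : complex K -> tau != finset.set0 ->
  c \notin tau -> (forall A, A \in K -> tau \subset A -> c |: A \in K) ->
  homotopy_equivalent R (realization R K) (realization R (remove_star K tau)).
Proof.
move=> cK t0 ct apex.
have gsub (x : coords R V) : geom (remove_star K tau) x -> geom K x.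
  by move=> [x0 x1]; rewrite inE => /andP[xK _].
have crem : complex (remove_star K tau).
  move=> A B AB; rewrite !inE => /andP[BK tB]; rewrite (cK _ _ AB BK).
  by apply: contra tB => tA; exact: fintype.subset_trans AB.
have common x : geom K x -> exists2 C, C \in K &
    forall v, v \notin C -> x v = 0 /\ push tau c x v = 0.
  move=> gx; have [x0 x1 xK] := gx.
  have [tx|/(min_coord_eq0 gx t0) m0] := boolP (tau \subset [set v | x v != 0]%SET).
    exists (c |: [set v | x v != 0]%SET); first exact: apex.
    move=> v; rewrite !inE negb_or negbK => /andP[/negbTE vc /eqP xv].
    have /negbTE vt : v \notin tau.
      by apply/negP => /(fintype.subsetP tx); rewrite inE xv eqxx.
    by rewrite /push xv vc vt !mul0r subr0 addr0.
  exists [set v | x v != 0]%SET => // v; rewrite inE negbK => /eqP xv.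
  by rewrite /push xv m0 !mulr0 subr0 addr0.
have gpush x : geom K x -> geom (remove_star K tau) (push tau c x).
  move=> gx; have [x0 x1 xK] := gx.
  have m0 := min_coord_ge0 tau x0.
  have [v tv mv] := min_coord_attained gx t0.
  have [C CK xC] := common _ gx.
  apply: (@geom_sub _ _ _ (C :\ v)) => //.
  - rewrite inE; apply/andP; split; first by apply: cK CK; exact: subsetDl.
    by apply/subsetPn; exists v => //; rewrite !inE eqxx.
  - move=> w; rewrite /push; apply: addr_ge0; last by rewrite !mulr_ge0.
    have [tw|_] := boolP (w \in tau); last by rewrite mul0r subr0.
    by rewrite mul1r subr_ge0 min_coord_le.
  - rewrite /push big_split /= sumrB x1 -!mulr_suml.
    have -> : \sum_w (w \in tau)%:R = #|tau|%:R :> R.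
      by rewrite -natr_sum -sum1_card [in RHS]big_mkcond.
    rewrite (bigD1 c) //= eqxx big1 ?addr0 ?mul1r ?subrK //.
    by move=> w /negbTE ->.
  - move=> w; rewrite !inE negb_and negbK => /orP[/eqP ->|/xC[] //].
    have /negbTE vc : v != c by apply: contraNneq ct => <-.
    by rewrite /push tv vc mv mul1r mul0r addr0 subrr.
have gval (x : realization R K) : geom K (\val x) by exact: set_mem (valP x).
have gval' (x : realization R (remove_star K tau)) :
  geom (remove_star K tau) (\val x) by exact: set_mem (valP x).
pose r (x : realization R K) : realization R (remove_star K tau) :=
  sub_pt (gpush _ (gval x)).
pose i (x : realization R (remove_star K tau)) : realization R K :=
  sub_pt (gsub _ (gval' x)).
have cval : continuous (fun x : realization R K => \val x : coords R V).
  exact: cts_val.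
have cr : continuous (fun x : realization R K => push tau c (\val x)).
  apply: cts_into_prod; apply: cts_push => v.
  by apply: (@cts_comp _ _ _ (fun x : realization R K => \val x : coords R V)
    (fun y : coords R V => y v)) => //; exact: cts_coord.
exists r, i; split.
- exact: cts_into_sub.
- by apply: cts_into_sub; exact: cts_val.
- apply: straight_homotopy => //.
  + by apply: cts_into_sub.
  + by move=> x; exact: cvg_id.
  + move=> x; have [C CK xC] := common _ (gval x).
    by exists C => // v /xC[? ?].
- rewrite (_ : r \o i = id); first by apply: homotopic_refl => x; exact: cvg_id.
  apply/funext => x; apply: val_inj => /=; apply/funext => v.
  have gx := gsub _ (gval' x); have [_ _] := gval' x; rewrite inE => /andP[_ tx].
  by rewrite /push (min_coord_eq0 gx t0 tx) !mulr0 subr0 addr0.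
Qed.

Definition avoid K (ts : seq ({set V} * V)) : {set {set V}} :=
  [set A in K | all (fun p : {set V} * V => ~~ (p.1 \subset A)) ts]%SET.

(** Stars are removed one after the other. As no apex belongs to a set whose star
    is removed, the extension of a simplex by an apex never falls into a star
    that has been removed before. *)
Lemma avoid_equiv K ts : complex K ->
  {in ts, forall p : {set V} * V, p.1 != finset.set0 /\
     (forall A, A \in K -> p.1 \subset A -> p.2 |: A \in K)} ->
  {in ts &, forall p q : {set V} * V, p.2 \notin q.1} ->
  homotopy_equivalent R (realization R K) (realization R (avoid K ts)).
Proof.
elim: ts K => [|[tau c] ts IHts] K cK apex ct.
  rewrite (_ : avoid K [::] = K); first exact: homotopy_equivalent_refl.
  by apply/setP => A; rewrite inE andbT.
have [|t0 tA] := apex (tau, c); first by rewrite mem_head.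
have tsS p : p \in ts -> p \in (tau, c) :: ts by rewrite inE orbC => ->.
apply: (homotopy_equivalent_trans (remove_star_equiv cK t0 _ tA)).
  by apply: (ct (tau, c) (tau, c)); rewrite mem_head.
rewrite (_ : avoid K _ = avoid (remove_star K tau) ts); last first.
  by apply/setP => A; rewrite !inE /= andbA.
apply: IHts.
- move=> A B AB; rewrite !inE => /andP[BK tB]; rewrite (cK _ _ AB BK).
  by apply: contra tB => tB; exact: fintype.subset_trans AB.
- move=> p pts; have [p0 pA] := apex _ (tsS _ pts); split => // A.
  rewrite !inE => /andP[AK nA] pA'; rewrite pA //.
  apply: contra nA => /fintype.subsetP tA'; apply/fintype.subsetP => v tv.
  have := tA' _ tv; rewrite !inE => /orP[/eqP e|//].
  have := ct p (tau, c) (tsS _ pts) (mem_head _ _).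
  by rewrite /= -e tv.
- by move=> p q pts qts; apply: ct; exact: tsS.
Qed.

End collapse.

(** * Embeddings onto realizations *)

(** The map goes to the ambient space of coordinates, not to the realization,
    so that pieces of a join, a suspension or a wedge can be embedded in one
    space over a common vertex set and compared there. *)
Definition embedding (R : realType) (V : finType) (X : topologicalType)
    (K : {set {set V}}) (f : X -> coords R V) : Prop :=
  [/\ compact [set: X], continuous f, injective f & range f = geom K].

Section embedding.
Variables (R : realType) (V : finType).
Implicit Types (X Y : topologicalType) (K L : {set {set V}}).

Lemma hausdorff_realization K : hausdorff_space (realization R K).
Proof.
move=> p q pq; apply: val_inj.
have hc : hausdorff_space (coords R V).
  by apply: hausdorff_product => _; exact: Rhausdorff.
apply: hc => A B pA qB.
have [||z [Az Bz]] := pq ((fun z => \val z) @^-1` A) ((fun z => \val z) @^-1` B).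
- exact: (@cts_val _ _ p A pA).
- exact: (@cts_val _ _ q B qB).
- by exists (\val z).
Qed.

(** A continuous bijection from a compact space to a Hausdorff one is a
    homeomorphism. *)
Lemma embedding_equiv X K (f : X -> coords R V) :
  embedding K f -> homotopy_equivalent R X (realization R K).
Proof.
move=> [cX cf fi fK].
have gf x : geom K (f x) by rewrite -fK; exists x.
pose f' x : realization R K := sub_pt (gf x).
have cf' : continuous f' by exact: cts_into_sub.
have /choice[g gP] (y : realization R K) : exists x, f x = \val y.
  have : geom K (\val y) by exact: set_mem (valP y).
  by rewrite -fK => -[x _ <-]; exists x.
have gfK x : g (f' x) = x by apply: fi; rewrite gP.
have fgK y : f' (g y) = y by apply: val_inj => /=; rewrite gP.
have cg : continuous g.
  apply/continuous_closedP => A cA.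
  have -> : g @^-1` A = f' @` A.
    rewrite eqEsubset; split => y /=; first by exists (g y).
    by move=> [x Ax <-]; rewrite gfK.
  apply: compact_closed; first exact: hausdorff_realization.
  apply: continuous_compact; first exact: continuous_subspaceT.
  exact: (subclosed_compact cA cX).
exists f', g; split => //.
- rewrite (_ : g \o f' = id); last by apply/funext => x /=.
  by apply: homotopic_refl => x; exact: cvg_id.
- rewrite (_ : f' \o g = id); last by apply/funext => x /=.
  by apply: homotopic_refl => x; exact: cvg_id.
Qed.

Lemma embedding_realization K : complex K ->
  embedding K (fun x : realization R K => \val x : coords R V).
Proof.
move=> cK; split; [exact: compact_realization|exact: cts_val|exact: val_inj|].
rewrite eqEsubset; split => x; first by move=> [y _ <-]; exact: set_mem (valP y).
by move=> gx; exists (sub_pt gx).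
Qed.

Lemma embedding_void X K (f : X -> coords R V) : (X -> False) ->
  K = [set finset.set0]%SET -> embedding K f.
Proof.
move=> X0 ->; split.
- by rewrite (_ : setT = set0) ?eqEsubset; [exact: compact0|split => // x; have := X0 x].
- by move=> x; have := X0 x.
- by move=> x; have := X0 x.
- rewrite eqEsubset; split => x; first by move=> [y]; have := X0 y.
  move=> [_ x1]; rewrite inE => /eqP/setP x0.
  move/eqP: x1; rewrite big1 ?(eq_sym 0) ?oner_eq0 // => v _.
  by have := x0 v; rewrite !inE => /negbFE/eqP.
Qed.

End embedding.

(** * Injections of vertex sets *)

Section relabel.
Variables (R : realType) (V W : finType) (j : V -> W).
Hypothesis ji : injective j.

Definition relabel (x : coords R V) : coords R W :=
  fun w => \sum_(v | j v == w) x v.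

Definition relabel_complex (K : {set {set V}}) : {set {set W}} :=
  [set j @: (A : {set V}) | A in K]%SET.

Lemma relabelE x v : relabel x (j v) = x v.
Proof.
rewrite /relabel (big_pred1 v) // => u.
by rewrite (inj_eq ji) /=.
Qed.

Lemma relabel0 x w : (forall v, j v != w) -> relabel x w = 0.
Proof. by move=> jw; rewrite /relabel big_pred0 // => v; apply/negbTE. Qed.

Lemma embedding_relabel (X : topologicalType) K (f : X -> coords R V) :
  embedding K f -> embedding (relabel_complex K) (relabel \o f).
Proof.
move=> [cX cf fi fK]; split => //.
- apply: cts_into_prod => w; apply: cts_sum => v.
  exact: cts_eval.
- move=> x y /= e; apply: fi; apply/funext => v.
  by have := congr1 (fun z : coords R W => z (j v)) e; rewrite /= !relabelE.
have supp x : [set w | relabel x w != 0]%SET = (j @: [set v | x v != 0])%SET.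
  apply/setP => w; rewrite inE; apply/idP/imsetP.
    have [[v <-]|nw] := pselect (exists v, j v = w).
      by rewrite relabelE => xv; exists v => //; rewrite inE.
    rewrite relabel0 ?eqxx // => v.
    by apply/eqP => jv; apply: nw; exists v.
  by move=> [v]; rewrite inE => xv ->; rewrite relabelE.
have sum x : \sum_w relabel x w = \sum_v x v.
  by rewrite (partition_big j predT).
rewrite eqEsubset; split => y.
  move=> [x _ <-] /=; have : geom K (f x) by rewrite -fK; exists x.
  move=> [x0 x1 xK]; split; first by move=> w; exact: sumr_ge0.
    by rewrite sum.
  by rewrite supp; apply: imset_f.
move=> [y0 y1] /imsetP[A AK yA].
have yE : relabel (fun v => y (j v)) = y.
  apply/funext => w.
  have [[v <-]|nw] := pselect (exists v, j v = w); first by rewrite relabelE.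
  rewrite relabel0; last by move=> v; apply/eqP => jv; apply: nw; exists v.
  apply/esym/eqP/negPn/negP => yw.
  have : w \in [set w | y w != 0]%SET by rewrite inE.
  by rewrite yA => /imsetP[v _ e]; apply: nw; exists v.
have gx : geom K (fun v => y (j v)).
  split; [by move=> v|by rewrite -sum yE|].
  rewrite (_ : [set v | y (j v) != 0]%SET = A) //.
  apply/setP => v; rewrite inE.
  have : (j v \in [set w | y w != 0]%SET) = (j v \in (j @: A)%SET) by rewrite yA.
  by rewrite inE (mem_imset _ _ ji).
move: gx; rewrite -fK => -[x _ e].
by exists x => //=; rewrite e.
Qed.

Lemma complex_relabel (K : {set {set V}}) :
  complex K -> complex (relabel_complex K).
Proof.
move=> cK A B AB /imsetP[C CK e]; apply/imsetP; exists (j @^-1: A)%SET.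
  apply: cK CK; apply/fintype.subsetP => u; rewrite inE => /(fintype.subsetP AB).
  by rewrite e (mem_imset _ _ ji).
apply/setP => w; apply/idP/imsetP => [wA|[u]]; last by rewrite inE => uA ->.
have := fintype.subsetP AB _ wA; rewrite e => /imsetP[u _ wu].
by exists u => //; rewrite inE -wu.
Qed.

Lemma relabel_complex0 (K : {set {set V}}) :
  finset.set0 \in K -> finset.set0 \in relabel_complex K.
Proof. by move=> K0; apply/imsetP; exists finset.set0; rewrite ?imset0. Qed.

End relabel.

(** * Maps out of a double mapping cylinder *)

Section double_cylinder.
Local Open Scope quotient_scope.
Variables (R : realType) (X Y Z T : topologicalType) (f : Z -> X) (g : Z -> Y).
Variables (F0 : X -> T) (F1 : Y -> T) (H : Z * unit_interval R -> T).
Hypothesis H0 : forall z t, \val t = 0 -> H (z, t) = F0 (f z).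
Hypothesis H1 : forall z t, \val t = 1 -> H (z, t) = F1 (g z).

Let C := @double_cylinder R X Y Z f g.
Let pi (p : cyl_sum R X Y Z) : C := cyl_pi f g p.

Definition cyl_mid (zt : Z * unit_interval R) : cyl_sum R X Y Z :=
  existT (cyl_part R X Y Z) None zt.

Definition cyl_sum_map (p : cyl_sum R X Y Z) : T :=
  match p with
  | existT None zt => H zt
  | existT (Some false) x => F0 x
  | existT (Some true) y => F1 y
  end.

Definition cyl_map (w : C) : T :=
  cyl_sum_map (repr (w : {eq_quot (@cyl_rel R X Y Z f g)})).

Lemma cyl_sum_map_nf p : cyl_sum_map (cyl_nf f g p) = cyl_sum_map p.
Proof.
case: p => -[[]|] //= [z t] /=.
case: ifP => [/eqP t0|_]; first by rewrite /= H0.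
by case: ifP => [/eqP t1|_] //=; rewrite H1.
Qed.

Lemma cyl_mapE p : cyl_map (pi p) = cyl_sum_map p.
Proof.
rewrite /cyl_map /pi /cyl_pi; case: piP => q /eqmodP /eqP e.
by rewrite -cyl_sum_map_nf -[RHS]cyl_sum_map_nf e.
Qed.

Lemma cyl_ind (w : C) :
  [\/ exists x, w = pi (cyl_left R Y Z x), exists y, w = pi (cyl_right R X Z y) |
      exists z t, 0 < \val t < 1 /\ w = pi (cyl_mid (z, t))].
Proof.
have [p ->] : exists p, w = pi p.
  exists (repr (w : {eq_quot (@cyl_rel R X Y Z f g)})).
  by rewrite /pi /cyl_pi reprK.
case: p => -[[]|] /=.
- by move=> y; apply: Or32; exists y.
- by move=> x; apply: Or31; exists x.
- move=> [z t]; have /andP[t0 t1] := unit_interval_bounds t.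
  have [e0|n0] := eqVneq (\val t) 0.
    apply: Or31; exists (f z); apply/eqmodP/eqP => /=.
    by rewrite e0 eqxx.
  have [e1|n1] := eqVneq (\val t) 1.
    apply: Or32; exists (g z); apply/eqmodP/eqP => /=.
    by rewrite (negbTE n0) e1 eqxx.
  apply: Or33; exists z, t; split => //.
  by rewrite !lt_neqAle t0 t1 eq_sym n0 n1.
Qed.

Lemma cts_cyl_map : continuous F0 -> continuous F1 -> continuous H ->
  continuous cyl_map.
Proof.
move=> c0 c1 cH.
have cs : continuous cyl_sum_map.
  move=> [[[]|] p] /=; rewrite /continuous_at /=; [exact: c1|exact: c0|exact: cH].
apply: (repr_comp_continuous cs) => p q /eqP/eqmodP/eqP e; apply/eqP.
by rewrite -cyl_sum_map_nf -[RHS]cyl_sum_map_nf e.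
Qed.

(** A real function that recovers the parameter from the image separates the two
    ends from each other and from the interior, and reduces injectivity to
    injectivity at each level. *)
Lemma cyl_map_inj (height : T -> R) :
  (forall x, height (F0 x) = 0) -> (forall y, height (F1 y) = 1) ->
  (forall z t, height (H (z, t)) = \val t) ->
  injective F0 -> injective F1 ->
  (forall z z' t, 0 < \val t < 1 -> H (z, t) = H (z', t) -> z = z') ->
  injective cyl_map.
Proof.
move=> h0 h1 hH i0 i1 iH w w'.
case: (cyl_ind w) => [[x ->]|[y ->]|[z [t [t01 ->]]]];
case: (cyl_ind w') => [[x' ->]|[y' ->]|[z' [t' [t01' ->]]]];
  rewrite !cyl_mapE /= => e.
- by rewrite (i0 _ _ e).
- by exfalso; have := congr1 height e; rewrite h0 h1; lra.
- by exfalso; have := congr1 height e; rewrite h0 hH; lra.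
- by exfalso; have := congr1 height e; rewrite h0 h1; lra.
- by rewrite (i1 _ _ e).
- by exfalso; have := congr1 height e; rewrite h1 hH; lra.
- by exfalso; have := congr1 height e; rewrite h0 hH; lra.
- by exfalso; have := congr1 height e; rewrite h1 hH; lra.
- have tt' : t = t' by apply: val_inj; rewrite -(hH z t) e hH.
  by rewrite -tt' in e *; rewrite (iH _ _ _ t01 e).
Qed.

Lemma range_cyl_map (G : set T) :
  (forall x, G (F0 x)) -> (forall y, G (F1 y)) -> (forall p, G (H p)) ->
  (forall p, G p -> [\/ exists x, F0 x = p, exists y, F1 y = p |
                        exists q, H q = p]) ->
  range cyl_map = G.
Proof.
move=> G0 G1 GH sG; rewrite eqEsubset; split => p.
  move=> [w _ <-].
  by case: (cyl_ind w) => [[x ->]|[y ->]|[z [t [t01 ->]]]]; rewrite cyl_mapE /=.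
move=> /sG[[x <-]|[y <-]|[q <-]].
- by exists (pi (cyl_left R Y Z x)) => //; rewrite cyl_mapE.
- by exists (pi (cyl_right R X Z y)) => //; rewrite cyl_mapE.
- by exists (pi (cyl_mid q)) => //; rewrite cyl_mapE.
Qed.

Lemma compact_cylinder : compact [set: X] -> compact [set: Y] ->
  compact [set: Z] -> compact [set: C].
Proof.
move=> cX cY cZ.
have cS : compact [set: cyl_sum R X Y Z].
  apply: sigT_compact; first exact: finite_finset.
  move=> -[[]|] //=.
  rewrite -setXTT; apply: compact_setX => //.
  by apply: compact_set_type; exact: segment_compact.
rewrite (_ : setT = pi @` setT).
  apply: continuous_compact => //; apply: continuous_subspaceT.
  exact: pi_continuous.
rewrite eqEsubset; split => // w _.
exists (repr (w : {eq_quot (@cyl_rel R X Y Z f g)})) => //.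
by rewrite /pi /cyl_pi reprK.
Qed.

End double_cylinder.

(** * Joins *)

Section join_suspension.
Variables (R : realType) (V : finType).
Implicit Types (X Y : topologicalType) (K L : {set {set V}}).

Definition join_complex K L : {set {set V}} :=
  [set (A : {set V}) :|: (B : {set V}) | A in K, B in L]%SET.

Definition vtx (v : V) : coords R V := fun u => (u == v)%:R.

Lemma geom_vtx K v : complex K -> [set v]%SET \in K -> geom K (vtx v).
Proof.
move=> cK vK; apply: (geom_sub cK vK).
- by move=> u; rewrite ler0n.
- rewrite /vtx (bigD1 v) //= eqxx big1 ?addr0 // => u /negbTE uv.
  by rewrite uv.
- by move=> u; rewrite inE /vtx => /negbTE ->.
Qed.

Lemma geom_vtx_eq K v x : geom K x -> (forall u, u != v -> x u = 0) -> x = vtx v.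
Proof.
move=> [_ x1 _] xv; apply/funext => u; rewrite /vtx.
have [->|/xv //] := eqVneq u v.
by rewrite -x1 (bigD1 v) //= big1 ?addr0 // => w /xv.
Qed.

Lemma complex_join K L : complex K -> complex L -> complex (join_complex K L).
Proof.
move=> cK cL A B AB /imset2P[C D CK DL e].
rewrite -(finset.setIidPl AB) e finset.setIUr; apply: imset2_f.
- by apply: cK CK; exact: subsetIr.
- by apply: cL DL; exact: subsetIr.
Qed.

(** The point at height t between x and y goes to (1 - t) f x + t g y. As the
    two complexes use disjoint vertices, t is the total mass outside [S], and f x
    and g y are the normalized restrictions to [S] and to its complement. *)
Lemma embedding_join X Y K L (S : {set V}) (f : X -> coords R V)
    (g : Y -> coords R V) :
  complex K -> complex L -> finset.set0 \in K -> finset.set0 \in L ->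
  (forall A, A \in K -> A \subset S) -> (forall B, B \in L -> B \subset ~: S) ->
  embedding K f -> embedding L g ->
  exists F : join R X Y -> coords R V, embedding (join_complex K L) F.
Proof.
move=> cK cL K0 L0 KS LS [cX cf fi fK] [cY cg gi gL].
have gf x : geom K (f x) by rewrite -fK; exists x.
have gg y : geom L (g y) by rewrite -gL; exists y.
have fS x v : v \notin S -> f x v = 0.
  move=> vS; have [C /KS CS xC] := geom_supp (gf x).
  by apply: xC; apply: contra vS; exact: (fintype.subsetP CS).
have gS y v : v \in S -> g y v = 0.
  move=> vS; have [C /LS CS xC] := geom_supp (gg y).
  by apply: xC; apply: contraL vS => /(fintype.subsetP CS); rewrite inE.
have cJ := complex_join cK cL.
pose H (p : (X * Y) * unit_interval R) : coords R V :=
  fun v => (1 - \val p.2) * f p.1.1 v + \val p.2 * g p.1.2 v.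
have H0 z t : \val t = 0 -> H (z, t) = f z.1.
  by move=> t0; apply/funext => v; rewrite /H /= t0 subr0 mul1r mul0r addr0.
have H1 z t : \val t = 1 -> H (z, t) = g z.2.
  by move=> t1; apply/funext => v; rewrite /H /= t1 subrr mul1r mul0r add0r.
exists (@cyl_map R X Y (X * Y)%type _ fst snd f g H).
split.
- by apply: compact_cylinder => //; rewrite -setXTT; exact: compact_setX.
- apply: cts_cyl_map => //; apply: cts_into_prod => v.
  have ct : continuous (fun p : (X * Y) * unit_interval R => \val p.2 : R).
    by apply: (@cts_comp _ _ _ snd); [exact: cts_snd|exact: cts_val].
  have cfv : continuous (fun p : (X * Y) * unit_interval R => f p.1.1 v : R).
    apply: (@cts_comp _ _ _ (fst \o fst) (fun x => f x v)).
      by apply: cts_comp; exact: cts_fst.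
    exact: cts_eval.
  have cgv : continuous (fun p : (X * Y) * unit_interval R => g p.1.2 v : R).
    apply: (@cts_comp _ _ _ (snd \o fst) (fun x => g x v)).
      by apply: cts_comp; [exact: cts_fst|exact: cts_snd].
    exact: cts_eval.
  by apply: ctsD; apply: ctsM => //; apply: ctsB => //; exact: cts_cst.
- have f0 x : \sum_(v | v \notin S) f x v = 0 by rewrite big1 // => v /fS.
  have g1 y : \sum_(v | v \notin S) g y v = 1.
    have [_ <- _] := gg y; rewrite [RHS](bigID (mem S)) /=.
    by rewrite [X in _ = X + _]big1 ?add0r // => v /gS.
  apply: (cyl_map_inj H0 H1 (height := fun z => \sum_(v | v \notin S) z v)) => //.
  + by move=> z t; rewrite /H /= big_split /= -!mulr_sumr f0 g1 mulr0 mulr1 add0r.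
  + move=> [x y] [x' y'] t t01 e; congr pair.
    * apply: fi; apply/funext => v; have [vS|vS] := boolP (v \in S); last by rewrite !fS.
      have := congr1 (fun z : coords R V => z v) e.
      rewrite /H /= !gS // !mulr0 !addr0; apply: mulfI.
      by rewrite subr_eq0 eq_sym; case/andP: t01 => _ /lt_eqF ->.
    * apply: gi; apply/funext => v; have [vS|vS] := boolP (v \in S); first by rewrite !gS.
      have := congr1 (fun z : coords R V => z v) e.
      rewrite /H /= !fS // !mulr0 !add0r; apply: mulfI.
      by case/andP: t01 => /gt_eqF ->.
- apply: (range_cyl_map H0 H1).
  + move=> x; have [x0 x1 xK] := gf x; split => //.
    by apply/imset2P; exists [set v | f x v != 0]%SET finset.set0; rewrite // finset.setU0.
  + move=> y; have [y0 y1 yL] := gg y; split => //.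
    by apply/imset2P; exists finset.set0 [set v | g y v != 0]%SET; rewrite // finset.set0U.
  + move=> [[x y] t]; have /andP[t0 t1] := unit_interval_bounds t.
    have [x0 x1 _] := gf x; have [y0 y1 _] := gg y.
    have [C CK xC] := geom_supp (gf x); have [D DL yD] := geom_supp (gg y).
    apply: (@geom_sub _ _ _ (C :|: D)%SET) => //.
    * by apply/imset2P; exists C D.
    * by move=> v; rewrite /H /= addr_ge0 ?mulr_ge0 ?subr_ge0.
    * by rewrite /H /= big_split /= -!mulr_sumr x1 y1; lra.
    * move=> v; rewrite inE negb_or => /andP[vC vD].
      by rewrite /H /= xC // yD // !mulr0 addr0.
  + move=> z gz; have [z0 z1 /imset2P[A B AK BL zAB]] := gz.
    have zE v : v \notin A -> v \notin B -> z v = 0.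
      move=> vA vB; apply/eqP/negPn.
      have : v \notin (A :|: B)%SET by rewrite inE negb_or vA.
      by rewrite -zAB inE.
    have AS := fintype.subsetP (KS _ AK).
    have BS v : v \in B -> v \notin S.
      by move/(fintype.subsetP (LS _ BL)); rewrite inE.
    pose s := \sum_(v in S) z v; pose t := \sum_(v | v \notin S) z v.
    have st : s + t = 1 by rewrite -z1 [RHS](bigID (mem S)).
    have s0 : 0 <= s by apply: sumr_ge0.
    have t0 : 0 <= t by apply: sumr_ge0.
    have inK : s != 0 -> exists x, f x = (fun v => (v \in S)%:R * z v / s).
      move=> sn0; suff : geom K (fun v => (v \in S)%:R * z v / s).
        by rewrite -fK => -[x _ <-]; exists x.
      apply: (geom_sub cK AK).
      - by move=> v; rewrite divr_ge0 // mulr_ge0.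
      - rewrite -mulr_suml (_ : \sum__ _ = s) ?divff // /s [RHS]big_mkcond /=.
        by apply: eq_bigr => v _; case: (v \in S); rewrite ?mul1r ?mul0r.
      - move=> v vA; have [vS|] := boolP (v \in S); last by rewrite !mul0r.
        by rewrite zE ?mulr0 ?mul0r //; apply: contraL vS; exact: BS.
    have inL : t != 0 -> exists y, g y = (fun v => (v \notin S)%:R * z v / t).
      move=> tn0; suff : geom L (fun v => (v \notin S)%:R * z v / t).
        by rewrite -gL => -[x _ <-]; exists x.
      apply: (geom_sub cL BL).
      - by move=> v; rewrite divr_ge0 // mulr_ge0.
      - rewrite -mulr_suml (_ : \sum__ _ = t) ?divff // /t [RHS]big_mkcond /=.
        by apply: eq_bigr => v _; case: (v \in S); rewrite ?mul1r ?mul0r.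
      - move=> v vB; have [vS|vS] := boolP (v \in S); first by rewrite !mul0r.
        by rewrite zE ?mulr0 ?mul0r //; apply: contra vS; exact: AS.
    have z_in v : s = 0 -> v \in S -> z v = 0.
      by move=> s00 vS; apply/eqP; move/eqP: s00; rewrite psumr_eq0 // => /allP/(_ v);
        rewrite mem_index_enum vS => /(_ isT).
    have z_out v : t = 0 -> v \notin S -> z v = 0.
      by move=> t00 vS; apply/eqP; move/eqP: t00; rewrite psumr_eq0 // => /allP/(_ v);
        rewrite mem_index_enum vS => /(_ isT).
    have [t00|tn0] := eqVneq t 0.
      have s1 : s = 1 by rewrite -st t00 addr0.
      have [|x xE] := inK; first by rewrite s1 oner_eq0.
      apply: Or31; exists x; rewrite xE; apply/funext => v; rewrite s1 divr1.
      by have [vS|vS] := boolP (v \in S); rewrite ?mul1r ?mul0r // z_out.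
    have [s00|sn0] := eqVneq s 0.
      have t1 : t = 1 by rewrite -st s00 add0r.
      have [y yE] := inL tn0.
      apply: Or32; exists y; rewrite yE; apply/funext => v; rewrite t1 divr1.
      by have [vS|vS] := boolP (v \in S); rewrite ?mul1r ?mul0r // z_in.
    have [x xE] := inK sn0; have [y yE] := inL tn0.
    apply: Or33; exists ((x, y), clamp t); apply/funext => v; rewrite /H.
    rewrite clampE ?t0 /=; last by rewrite -st lerDr.
    rewrite xE yE -[X in X - t]st addrK.
    have [vS|vS] := boolP (v \in S).
      by rewrite mul1r !mul0r mulr0 addr0 mulrC divfK.
    by rewrite mul1r !mul0r mulr0 add0r mulrC divfK.
Qed.

End join_suspension.

(** * Suspensions and wedges *)

Section suspension_coefficients.
Variable R : realType.
Implicit Types a b c t : R.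

(** The meridian of a suspension through x runs straight from the pole s to x, and
    then straight from x to the pole n; at height t its point has the
    coordinates [lo t] at s and [hi t] at n, and the mass [mid t] on the
    simplex of x. *)
Definition lo t := Num.max 0 (1 - (t + t)).
Definition hi t := Num.max 0 (t + t - 1).
Definition mid t := Num.min (t + t) (1 + 1 - (t + t)).

Lemma suspension_coefs t : 0 <= t <= 1 ->
  [/\ 0 <= lo t, 0 <= hi t, 0 <= mid t & lo t + hi t + mid t = 1] /\
  (lo t = 0 \/ hi t = 0).
Proof.
move=> /andP[t0 t1]; rewrite /lo /hi /mid.
have [th|th] := leP t (1 / 2).
  rewrite max_r; last by lra.
  rewrite max_l; last by lra.
  rewrite min_l; last by lra.
  by split; [split; lra|right].
rewrite max_l; last by lra.
rewrite max_r; last by lra.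
rewrite min_r; last by lra.
by split; [split; lra|left].
Qed.

(** This makes the height a function of the coordinates at the two poles. *)
Lemma height_coefs t : (hi t - lo t + 1) / 2 = t.
Proof.
rewrite /lo /hi; have [th|th] := leP t (1 / 2).
  rewrite max_l; last by lra.
  by rewrite max_r; lra.
rewrite max_r; last by lra.
by rewrite max_l; lra.
Qed.

Lemma mid_gt0 t : 0 < t < 1 -> 0 < mid t.
Proof. by move=> /andP[t0 t1]; rewrite /mid lt_min; apply/andP; split; lra. Qed.

Lemma solve_coefs a b c : 0 <= a -> 0 <= b -> 0 < c -> a + (b + c) = 1 ->
  a = 0 \/ b = 0 -> let t := (b - a + 1) / 2 in
  [/\ 0 <= t <= 1, lo t = a, hi t = b & mid t = c].
Proof.
move=> a0 b0 c0 abc ab t; have tE : t + t = b - a + 1 by rewrite /t; lra.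
rewrite /lo /hi /mid tE; split.
- by apply/andP; split; lra.
- by case: ab => e; [rewrite max_l|rewrite max_r]; lra.
- by case: ab => e; [rewrite max_r|rewrite max_l]; lra.
- by case: ab => e; [rewrite min_r|rewrite min_l]; lra.
Qed.

Lemma coefs0 : [/\ lo 0 = 1, hi 0 = 0 & mid 0 = 0].
Proof. by rewrite /lo /hi /mid; split; [rewrite max_r|rewrite max_l|rewrite min_l]; lra. Qed.

Lemma coefs1 : [/\ lo 1 = 0, hi 1 = 1 & mid 1 = 0].
Proof. by rewrite /lo /hi /mid; split; [rewrite max_l|rewrite max_r|rewrite min_r]; lra. Qed.

End suspension_coefficients.

Section suspension.
Variables (R : realType) (V : finType) (s n : V).
Hypothesis sn : s != n.
Implicit Types (X : topologicalType) (K : {set {set V}}).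

Definition poles : {set {set V}} := [set finset.set0; [set s]; [set n]]%SET.

Definition suspension_complex K := join_complex K poles.

Lemma complex_poles : complex poles.
Proof.
move=> A B AB; rewrite !inE -orbA => /or3P[] /eqP e; move: AB; rewrite e.
- by rewrite finset.subset0 => ->.
- by rewrite finset.subset1 => /orP[] ->; rewrite ?orbT.
- by rewrite finset.subset1 => /orP[] ->; rewrite ?orbT.
Qed.

Lemma complex_suspension K : complex K -> complex (suspension_complex K).
Proof. by move=> cK; apply: complex_join => //; exact: complex_poles. Qed.

Lemma embedding_suspension X K (f : X -> coords R V) :
  complex K -> finset.set0 \in K ->
  (forall A, A \in K -> s \notin A /\ n \notin A) -> embedding K f ->
  exists2 F : suspension R X -> coords R V,
    embedding (suspension_complex K) F & F (south_pole R X) = vtx R s.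
Proof.
move=> cK K0 Ksn [cX cf fi fK].
have gf x : geom K (f x) by rewrite -fK; exists x.
have fs x : f x s = 0.
  by have [C /Ksn[sC _] xC] := geom_supp (gf x); exact: xC.
have fn x : f x n = 0.
  by have [C /Ksn[_ nC] xC] := geom_supp (gf x); exact: xC.
have cS := complex_suspension cK.
have ns : (n == s) = false by rewrite eq_sym (negbTE sn).
have sn' : (s == n) = false by rewrite (negbTE sn).
pose H (p : X * unit_interval R) : coords R V :=
  fun v => lo (\val p.2) * vtx R s v + hi (\val p.2) * vtx R n v
         + mid (\val p.2) * f p.1 v.
pose F0 (_ : unit) := vtx R s; pose F1 (_ : unit) := vtx R n.
have H0 z t : \val t = 0 -> H (z, t) = F0 tt.
  have [l0 h0 m0] := coefs0 R.
  move=> t0; apply/funext => v; rewrite /H /= t0 l0 h0 m0.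
  by rewrite mul1r !mul0r !addr0.
have H1 z t : \val t = 1 -> H (z, t) = F1 tt.
  have [l1 h1 m1] := coefs1 R.
  move=> t1; apply/funext => v; rewrite /H /= t1 l1 h1 m1.
  by rewrite mul1r !mul0r add0r addr0.
have vv (v : V) : vtx R v v = 1 by rewrite /vtx eqxx.
have vsn : vtx R s n = 0 by rewrite /vtx ns.
have vns : vtx R n s = 0 by rewrite /vtx sn'.
have v1 (v : V) : \sum_u vtx R v u = 1.
  by rewrite /vtx (bigD1 v) //= eqxx big1 ?addr0 // => u /negbTE ->.
have memS A B : A \in K -> B \in poles -> (A :|: B)%SET \in suspension_complex K.
  by move=> AK BP; apply/imset2P; exists A B.
exists (@cyl_map R unit unit X _ (fun=> tt) (fun=> tt) F0 F1 H); last first.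
  by rewrite /south_pole cyl_mapE.
split.
- apply: compact_cylinder => //.
  + by rewrite (_ : setT = [set tt]) ?eqEsubset; [exact: compact_set1|split => // -[]].
  + by rewrite (_ : setT = [set tt]) ?eqEsubset; [exact: compact_set1|split => // -[]].
- apply: cts_cyl_map => //; [by move=> x; exact: cvg_cst|by move=> x; exact: cvg_cst|].
  apply: cts_into_prod => v.
  have ct : continuous (fun p : X * unit_interval R => \val p.2 : R).
    by apply: (@cts_comp _ _ _ snd); [exact: cts_snd|exact: cts_val].
  have cfv : continuous (fun p : X * unit_interval R => f p.1 v : R).
    apply: (@cts_comp _ _ _ fst (fun x => f x v)); first exact: cts_fst.
    exact: cts_eval.
  have c2 := ctsD ct ct.
  apply: ctsD; first apply: ctsD; apply: ctsM => //; try exact: cts_cst.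
  + by apply: cts_max; [exact: cts_cst|apply: ctsB => //; exact: cts_cst].
  + by apply: cts_max; [exact: cts_cst|apply: ctsB => //; exact: cts_cst].
  + by apply: cts_min => //; apply: ctsB => //; exact: cts_cst.
- apply: (cyl_map_inj H0 H1 (height := fun z => (z n - z s + 1) / 2)).
  + by move=> []; rewrite /F0 vv vsn sub0r addNr mul0r.
  + by move=> []; rewrite /F1 vv vns subr0 divff // gt_eqF ?addr_gt0.
  + move=> z t; rewrite /H /= !vv vsn vns fs fn !mulr0 !mulr1 !addr0 add0r.
    exact: height_coefs.
  + by move=> x y _; case: x; case: y.
  + by move=> x y _; case: x; case: y.
  + move=> x x' t t01 e; apply: fi; apply/funext => v.
    have m0 : mid (\val t) != 0 by rewrite gt_eqF // mid_gt0.
    by have := congr1 (fun z : coords R V => z v) e; rewrite /H /= => /addrI/(mulfI m0).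
- apply: (range_cyl_map H0 H1).
  + move=> []; apply: geom_vtx => //; rewrite -[[set s]%SET]finset.set0U.
    by apply: memS => //; rewrite !inE eqxx orbT.
  + move=> []; apply: geom_vtx => //; rewrite -[[set n]%SET]finset.set0U.
    by apply: memS => //; rewrite !inE eqxx orbT.
  + move=> [x t]; have [[l0 h0 m0 e1] lh] := suspension_coefs (unit_interval_bounds t).
    have [x0 x1 _] := gf x; have [C CK xC] := geom_supp (gf x).
    have Hn v : 0 <= H (x, t) v by rewrite /H /= !addr_ge0 ?mulr_ge0 ?ler0n.
    have Hs : \sum_v H (x, t) v = 1.
      by rewrite /H /= !big_split /= -!mulr_sumr x1 !v1 !mulr1.
    case: lh => [l00|h00].
    * apply: (@geom_sub _ _ _ (C :|: [set n])%SET) => //.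
        by apply: memS => //; rewrite !inE eqxx orbT.
      move=> v; rewrite !inE negb_or => /andP[vC /negbTE vn].
      by rewrite /H /= l00 xC // /vtx vn mul0r !mulr0 !addr0.
    * apply: (@geom_sub _ _ _ (C :|: [set s])%SET) => //.
        by apply: memS => //; rewrite !inE eqxx orbT.
      move=> v; rewrite !inE negb_or => /andP[vC /negbTE vs].
      by rewrite /H /= h00 xC // /vtx vs mul0r !mulr0 !addr0.
  + move=> z gz; have [z0 z1 /imset2P[A B AK BP zAB]] := gz.
    have [sA nA] := Ksn _ AK.
    have zE v : v \notin A -> v \notin B -> z v = 0.
      move=> vA vB; apply/eqP/negPn.
      have : v \notin (A :|: B)%SET by rewrite inE negb_or vA.
      by rewrite -zAB inE.
    have zsn : z s = 0 \/ z n = 0.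
      move: BP; rewrite !inE -orbA => /or3P[] /eqP e.
      - by left; apply: zE => //; rewrite e inE.
      - by right; apply: zE => //; rewrite e inE ns.
      - by left; apply: zE => //; rewrite e inE sn'.
    have zr v : v != s -> v != n -> v \notin A -> z v = 0.
      move=> vs vn vA; apply: zE => //; move: BP; rewrite !inE -orbA.
      by move=> /or3P[] /eqP ->; rewrite inE.
    pose c := \sum_(v | (v != s) && (v != n)) z v.
    have cE : z s + (z n + c) = 1.
      by rewrite -z1 (bigD1 s) //= (bigD1 n) //= eq_sym.
    have c0 : 0 <= c by apply: sumr_ge0.
    have zs0 := z0 s; have zn0 := z0 n.
    have [c00|cn0] := eqVneq c 0.
      have zin v : v != s -> v != n -> z v = 0.
        move=> vs vn; apply/eqP; move/eqP: c00; rewrite psumr_eq0 // => /allP/(_ v).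
        by rewrite mem_index_enum vs vn => /(_ isT).
      case: zsn => zz.
      * apply: Or32; exists tt; apply/esym/(geom_vtx_eq gz) => u un.
        by have [->//|us] := eqVneq u s; exact: zin.
      * apply: Or31; exists tt; apply/esym/(geom_vtx_eq gz) => u us.
        by have [->//|un] := eqVneq u n; exact: zin.
    have [x xE] : exists x, f x = (fun v => ((v != s) && (v != n))%:R * z v / c).
      suff : geom K (fun v => ((v != s) && (v != n))%:R * z v / c).
        by rewrite -fK => -[x _ <-]; exists x.
      apply: (geom_sub cK AK).
      - by move=> v; rewrite divr_ge0 // mulr_ge0.
      - rewrite -mulr_suml (_ : \sum__ _ = c) ?divff // /c [RHS]big_mkcond /=.
        by apply: eq_bigr => v _; case: ifP; rewrite ?mul1r ?mul0r.
      - move=> v vA; have [/andP[vs vn]|] := boolP ((v != s) && (v != n)).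
          by rewrite zr // mulr0 mul0r.
        by rewrite !mul0r.
    have cgt : 0 < c by rewrite lt_neqAle eq_sym cn0.
    apply: Or33; exists (x, clamp ((z n - z s + 1) / 2)).
    apply/funext => v; rewrite /H.
    have [tb loE hiE midE] := solve_coefs zs0 zn0 cgt cE zsn.
    rewrite clampE // /= xE loE hiE midE /vtx.
    have [->|vs] := eqVneq v s.
      by rewrite sn' /= !mulr0 !mul0r mulr0 mulr1 !addr0.
    have [->|vn] := eqVneq v n.
      by rewrite /= !mulr0 !mul0r mulr0 mulr1 addr0 add0r.
    by rewrite /= !mulr0 !add0r mul1r mulrC divfK.
Qed.

(** Two pieces share at most the vertex [s], hence the images of their embeddings
    share at most the image of the base points. *)
Lemma embedding_wedge (I : finType) (X : I -> topologicalType) (p : forall i, X i)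
    (K : I -> {set {set V}}) (f : forall i, X i -> coords R V) :
  (forall i, embedding (K i) (f i)) -> (forall i, f i (p i) = vtx R s) ->
  (forall i j A B, i != j -> A \in K i -> B \in K j -> A :&: B \subset [set s]%SET) ->
  embedding (\bigcup_i K i)%SET (wedge_fun (p0 := p) f).
Proof.
move=> fe fp disj.
have fpp i j : f i (p i) = f j (p j) by rewrite !fp.
have gf i x : geom (K i) (f i x) by have [_ _ _ <-] := fe i; exists x.
have wE (w : wedge p) : exists i x, w = @wedge_lift I X p i x.
  have : [set: wedge p] w by [].
  by rewrite -wedgeTE => -[i _ [x _ <-]]; exists i, x.
split.
- apply: wedge_compact; first exact: finite_finset.
  by move=> i; have [] := fe i.
- by apply: wedge_fun_continuous => // i; have [] := fe i.
- move=> w w'; have [i [x ->]] := wE w; have [j [y ->]] := wE w'.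
  rewrite !wedge_lift_funE // => e.
  have [ij|ij] := eqVneq i j.
    by move: y e; rewrite -ij => y e; have [_ _ fi _] := fe i; rewrite (fi _ _ e).
  have xv u : u != s -> f i x u = 0.
    move=> us; have [A AK xA] := geom_supp (gf i x).
    have [B BK yB] := geom_supp (gf j y).
    have [uA|/xA //] := boolP (u \in A).
    have [uB|/yB] := boolP (u \in B); last by rewrite e.
    have /fintype.subsetP/(_ u) := disj _ _ _ _ ij AK BK.
    by rewrite !inE uA uB (negbTE us) => /(_ isT).
  have fx : f i x = vtx R s by apply: geom_vtx_eq (gf i x) xv.
  have [_ _ fii _] := fe i; have [_ _ fij _] := fe j.
  rewrite (fii x (p i)) ?fx ?fp // (fij y (p j)) -?e ?fx ?fp //.
  exact: wedge_liftE.
- rewrite eqEsubset; split => z.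
    move=> [w _ <-]; have [i [x ->]] := wE w; rewrite wedge_lift_funE //.
    have [x0 x1 xK] := gf i x; split => //.
    by apply/bigcupP; exists i.
  move=> [z0 z1 /bigcupP[i _ zK]]; have [_ _ _ fiK] := fe i.
  have : geom (K i) z by split.
  rewrite -fiK => -[x _ <-]; exists (@wedge_lift I X p i x) => //.
  by rewrite wedge_lift_funE.
Qed.

End suspension.

(** * Fans of cones *)

Section collapse_family.
Variables (R : realType) (V : finType).

(** The form of [avoid_equiv] in which the stars to be removed are given by a
    property and the remaining complex by its simplices. *)
Lemma collapse (K K' : {set {set V}}) (P : {set V} -> V -> Prop) :
  complex K ->
  (forall A, A \in K' <-> A \in K /\ forall tau c, P tau c -> ~~ (tau \subset A)) ->
  (forall tau c, P tau c -> tau != finset.set0) ->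
  (forall tau c, P tau c -> forall A, A \in K -> tau \subset A -> c |: A \in K) ->
  (forall tau c tau' c', P tau c -> P tau' c' -> c \notin tau') ->
  homotopy_equivalent R (realization R K) (realization R K').
Proof.
move=> cK K'P P0 PK Pc.
pose ts := enum [pred p : {set V} * V | `[< P p.1 p.2 >]].
have tsP (p : {set V} * V) : p \in ts -> P p.1 p.2.
  by rewrite mem_enum => pP; apply/asboolP.
have -> : K' = avoid K ts.
  apply/setP => A; rewrite !inE; apply/idP/andP.
    by move=> /K'P[AK nA]; split => //; apply/allP => p /tsP; exact: nA.
  move=> [AK /allP nA]; apply/K'P; split => // tau c Pt.
  by apply: (nA (tau, c)); rewrite mem_enum; apply/asboolP.
apply: avoid_equiv => //.
- by move=> p /tsP pP; split; [exact: P0 pP|exact: PK pP].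
- by move=> p q /tsP pP /tsP; exact: Pc pP.
Qed.

Lemma complex_avoid (K K' : {set {set V}}) (P : {set V} -> V -> Prop) :
  complex K ->
  (forall A, A \in K' <-> A \in K /\ forall tau c, P tau c -> ~~ (tau \subset A)) ->
  complex K'.
Proof.
move=> cK K'P A B AB /K'P[BK nB]; apply/K'P; split; first exact: cK BK.
move=> tau c /nB; apply: contra => tA; exact: fintype.subset_trans AB.
Qed.

Lemma suspension_relabelP (U : finType) (j : U -> V) (K : {set {set U}}) (s n : V)
    (A : {set V}) : injective j -> s != n ->
  (forall u, j u != s) -> (forall u, j u != n) ->
  A \in suspension_complex s n (relabel_complex j K) <->
  [/\ forall w, w \in A -> [\/ w = s, w = n | exists u, w = j u],
      s \in A -> n \in A -> False & (j @^-1: A)%SET \in K].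
Proof.
move=> ji sn js jn; split.
  move=> /imset2P[_ S /imsetP[B BK ->] SP ->]; split.
  - move=> w; rewrite inE => /orP[/imsetP[u _ ->]|wS]; first by apply: Or33; exists u.
    move: SP wS; rewrite !inE -orbA => /or3P[] /eqP ->; rewrite inE // => /eqP ->.
      exact: Or31.
    exact: Or32.
  - have njs : s \notin (j @: B)%SET.
      by apply/imsetP => -[u _ e]; have := js u; rewrite e eqxx.
    have njn : n \notin (j @: B)%SET.
      by apply/imsetP => -[u _ e]; have := jn u; rewrite e eqxx.
    rewrite !inE (negbTE njs) (negbTE njn) /= => sS nS; move: SP.
    rewrite !inE -orbA => /or3P[] /eqP e; move: sS nS; rewrite e !inE //.
      by move=> _ /eqP ns; move: sn; rewrite ns eqxx.
    by move=> /eqP ns; move: sn; rewrite ns eqxx.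
  - rewrite (_ : finset.preimset _ _ = B) //; apply/setP => u.
    rewrite !inE (mem_imset _ _ ji) orb_idr //.
    move: SP; rewrite !inE -orbA => /or3P[] /eqP ->; rewrite inE //.
      by rewrite (negbTE (js u)).
    by rewrite (negbTE (jn u)).
move=> [Aw sA jA].
rewrite (_ : A = (j @: (j @^-1: A) :|: (A :&: [set s; n]))%SET).
  apply/imset2P; exists (j @: (j @^-1: A))%SET (A :&: [set s; n])%SET => //.
    exact: imset_f.
  rewrite !inE; have [sA'|sA'] := boolP (s \in A).
    have nA : n \notin A by apply/negP => /(sA sA').
    apply/orP; left; apply/orP; right; apply/eqP/setP => w; rewrite !inE.
    have [->|ws] := eqVneq w s; first by rewrite sA'.
    by have [->|wn] := eqVneq w n; rewrite ?(negbTE nA) ?andbF.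
  have [nA|nA] := boolP (n \in A).
    apply/orP; right; apply/eqP/setP => w; rewrite !inE.
    have [->|wn] := eqVneq w n; first by rewrite nA orbT.
    by have [->|ws] := eqVneq w s; rewrite ?(negbTE sA') ?andbF.
  apply/orP; left; apply/orP; left; apply/eqP/setP => w; rewrite !inE.
  have [->|wn] := eqVneq w n; first by rewrite (negbTE nA).
  by have [->|ws] := eqVneq w s; rewrite ?(negbTE sA') ?andbF.
apply/setP => w; rewrite !inE; apply/idP/orP.
  move=> wA; case: (Aw w wA) => [e|e|[u e]].
  - by right; rewrite wA e eqxx.
  - by right; rewrite wA e eqxx orbT.
  - by left; rewrite e; apply: imset_f; rewrite inE -e.
move=> [/imsetP[u]|/andP[]//]; by rewrite inE => uA ->.
Qed.

End collapse_family.

Section fan.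
Variables (U I : finType).

(** The vertices of all the complexes between the two sides: one apex [south], an
    apex [north i] for each index, the vertices of the base complex, and a
    copy of them for each index, which the last step moves the cones to. *)
Definition fan_vertex : finType := option (I + U + I * U)%type.
Definition south : fan_vertex := None.
Definition north (i : I) : fan_vertex := Some (inl (inl i)).
Definition base (u : U) : fan_vertex := Some (inl (inr u)).
Definition copy (i : I) (u : U) : fan_vertex := Some (inr (i, u)).

Definition bases (A : {set fan_vertex}) : {set U} := (base @^-1: A)%SET.
Definition copies (i : I) (A : {set fan_vertex}) : {set U} := (copy i @^-1: A)%SET.

(** The cone over [X] with apex [south] together with the cones over the [Y i]
    with apexes [north i]. No simplex contains two apexes. If [Y i] has no
    simplex at all, then [north i] is not a vertex. *)
Definition fan (X : {set {set U}}) (Y : I -> {set {set U}}) :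
    {set {set fan_vertex}} :=
  [set A : {set fan_vertex} | `[<
    [/\ forall i u, copy i u \notin A, bases A \in X,
        forall i, north i \in A -> south \notin A /\ bases A \in Y i &
        forall i j, north i \in A -> north j \in A -> i = j] >]]%SET.

Lemma fanP X Y A : A \in fan X Y <->
    [/\ forall i u, copy i u \notin A, bases A \in X,
        forall i, north i \in A -> south \notin A /\ bases A \in Y i &
        forall i j, north i \in A -> north j \in A -> i = j].
Proof. by rewrite inE; split => /asboolP. Qed.

End fan.

Arguments south {U I}.
Arguments north {U I}.
Arguments base {U I}.
Arguments copy {U I}.

(** * Splitting the cones along a vertex *)

Section add_vertex.
Variables (U I : finType).
Implicit Types (A : {set fan_vertex U I}).

Lemma bases_base u A : bases (base u |: A)%SET = (u |: bases A)%SET.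
Proof. by apply/setP => v; rewrite !inE. Qed.

Lemma bases_north i A : bases (north i |: A)%SET = bases A.
Proof. by apply/setP => v; rewrite !inE. Qed.

End add_vertex.

Section split.
Variables (R : realType) (U J : finType).
Let I := {set J}.

(** For an index [i] without [v], the cone over [Y i] becomes two cones, over the
    parts [Z i] and [Z (v |: i)] of [Y i]; this is an equivalence because these
    parts meet in a cone with apex [c]. *)
Lemma fan_split (X : {set {set U}}) (Y Z : I -> {set {set U}}) (v : J) (c : U) :
  complex X -> (forall i, complex (Z i)) -> (forall i, Z i \subset X) ->
  (forall i : I, v \notin i -> Y i = (Z i :|: Z (v |: i))%SET) ->
  (forall i : I, v \in i -> Y i = finset.set0) ->
  (forall (i : I) A, v \notin i -> A \in Z i -> A \in Z (v |: i)%SET ->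
     (c |: A)%SET \in Z i /\ (c |: A)%SET \in Z (v |: i)%SET) ->
  homotopy_equivalent R (realization R (fan X Y)) (realization R (fan X Z)).
Proof.
move=> cX cZ ZX Yout Yin apexZ.
have cY i : complex (Y i).
  have [vi|vi] := boolP (v \in i); first by rewrite Yin // => A B _; rewrite inE.
  rewrite Yout // => A B AB; rewrite !inE => /orP[] BZ.
    by rewrite (cZ _ _ _ AB BZ).
  by rewrite (cZ _ _ _ AB BZ) orbT.
have ZY (i : I) : v \in i -> forall A, A \in Z i -> A \in Y (i :\ v)%SET.
  move=> vi A AZ; rewrite Yout ?inE ?eqxx //.
  by rewrite finset.setD1K // AZ orbT.
pose W (i : I) := if v \in i then Z i else Y i.
have cW i : complex (W i) by rewrite /W; case: ifP.
(* In M both apexes of a pair are present, and they form an edge: the cone over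
   Y i with apex north i is extended by the cone with apex north (v |: i) over
   the cone over Z (v |: i). *)
pose M : {set {set fan_vertex U I}} := [set A : {set fan_vertex U I} | `[<
    [/\ forall i u, copy i u \notin A, bases A \in X,
        forall i, north i \in A -> south \notin A /\ bases A \in W i &
        forall i j : I, north i \in A -> north j \in A -> (i :\ v = j :\ v)%SET] >]]%SET.
have MP A : A \in M <->
    [/\ forall i u, copy i u \notin A, bases A \in X,
        forall i, north i \in A -> south \notin A /\ bases A \in W i &
        forall i j : I, north i \in A -> north j \in A -> (i :\ v = j :\ v)%SET].
  by rewrite inE; split => /asboolP.
have cM : complex M.
  move=> A B AB /MP[nc BX Bn Bu]; have AB' := fintype.subsetP AB.
  have bAB : bases A \subset bases B by exact: preimsetS.
  apply/MP; split.
  - by move=> i u; apply: contra (nc i u); exact: AB'.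
  - exact: cX bAB BX.
  - move=> i /AB' /Bn[sB BY]; split; first by apply: contra sB; exact: AB'.
    exact: cW bAB BY.
  - by move=> i j /AB' iB /AB' jB; exact: Bu.
have D1 (i : I) : v \notin i -> (i :\ v = i)%SET.
  move=> vi; apply/setP => w; rewrite !inE.
  by have [->|//] := eqVneq w v; rewrite (negbTE vi).
(* The new apexes are dominated by the old ones, as Z (v |: i) is part of Y i. *)
have MY : homotopy_equivalent R (realization R M) (realization R (fan X Y)).
  apply: (@collapse _ _ _ _ (fun tau c => exists i : I,
    [/\ v \in i, tau = [set north i]%SET & c = north (i :\ v)%SET])) => //.
  - move=> A; split.
      move=> /fanP[nc AX An Au]; split.
        apply/MP; split => //; last by move=> i j iA jA; rewrite (Au i j).
        move=> i /[dup] iA /An[sA AY]; split => //; rewrite /W; case: ifP => // vi.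
        by move: AY; rewrite Yin // inE.
      move=> _ _ [i [vi -> _]]; rewrite finset.sub1set; apply/negP => /An[_].
      by rewrite Yin // inE.
    move=> [/MP[nc AX An Au] nA].
    have out (i : I) : north i \in A -> v \notin i.
      move=> iA; apply/negP => vi.
      have : ~~ ([set north i]%SET \subset A) by apply: (nA _ (north (i :\ v)%SET)); exists i.
      by rewrite finset.sub1set iA.
    apply/fanP; split => //.
      move=> i /[dup] /out vi /An[sA]; rewrite /W (negbTE vi) => AY; split => //.
    move=> i j /[dup] /out vi iA /[dup] /out vj jA.
    by have := Au i j iA jA; rewrite !D1.
  - by move=> _ _ [i [_ -> _]]; apply/set0Pn; exists (north i); rewrite inE.
  - move=> _ _ [i [vi -> ->]] A /MP[nc AX An Au]; rewrite finset.sub1set => iA.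
    have [sA AW] := An i iA; rewrite /W vi in AW.
    apply/MP; split.
    + by move=> k u; rewrite !inE /= nc.
    + by rewrite bases_north.
    + move=> k; rewrite !inE bases_north => /orP[/eqP[->]|/An//].
      by split => //; rewrite /W !inE eqxx /=; exact: ZY.
    + have D k : north k \in (north (i :\ v) |: A)%SET -> (k :\ v = i :\ v)%SET.
        rewrite !inE => /orP[/eqP[->]|kA]; first by rewrite D1 // !inE eqxx.
        exact: Au.
      by move=> k l /D -> /D ->.
  - move=> _ _ _ _ [i [vi _ ->]] [i' [vi' -> _]]; rewrite inE.
    by apply/eqP => -[e]; move: vi'; rewrite -e !inE eqxx.
(* The cone at north i shrinks from Y i to Z i: what it loses lies over
   Z (v |: i), hence can be extended by north (v |: i). *)
pose M' : {set {set fan_vertex U I}} := [set A in M | `[< forall i : I,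
  v \notin i -> north i \in A -> bases A \in Z i >]]%SET.
have M'P A : A \in M' <-> A \in M /\ (forall i : I,
  v \notin i -> north i \in A -> bases A \in Z i).
  by rewrite inE; split => [/andP[? /asboolP ?]|[? ?]] //; apply/andP; split => //; apply/asboolP.
pose P2 (tau : {set fan_vertex U I}) (c : fan_vertex U I) := exists (i : I) (B : {set U}),
    [/\ v \notin i, B \notin Z i, tau = (north i |: [set base u | u in B])%SET
     & c = north (v |: i)%SET].
have subP2 (i : I) (B : {set U}) (A : {set fan_vertex U I}) :
    (north i |: [set base u | u in B])%SET \subset A = (north i \in A) && (B \subset bases A).
  rewrite finset.subUset finset.sub1set; congr andb.
  apply/fintype.subsetP/fintype.subsetP => s.
    by move=> u uB; rewrite inE; apply: s; exact: imset_f.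
  by move=> w /imsetP[u /s + ->]; rewrite inE.
have E2 A : A \in M' <-> A \in M /\ forall tau c, P2 tau c -> ~~ (tau \subset A).
  split.
    move=> /M'P[AM AZ]; split => // _ _ [i [B [vi BZ -> _]]]; rewrite subP2.
    apply/negP => /andP[iA BA]; have AZi := AZ i vi iA.
    by move: BZ; rewrite (cZ _ _ _ BA AZi).
  move=> [AM nA]; apply/M'P; split => // i vi iA; apply/negPn/negP => AZ.
  have : ~~ ((north i |: [set base u | u in bases A])%SET \subset A).
    by apply: (nA _ (north (v |: i)%SET)); exists i, (bases A).
  by rewrite subP2 iA fintype.subxx.
have MM' : homotopy_equivalent R (realization R M) (realization R M').
  apply: (@collapse _ _ _ _ P2) => //.
  - by move=> _ _ [i [B [_ _ -> _]]]; apply/set0Pn; exists (north i); rewrite !inE eqxx.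
  - move=> _ _ [i [B [vi BZ -> ->]]] A /MP[nc AX An Au]; rewrite subP2 => /andP[iA BA].
    have [sA] := An i iA; rewrite /W (negbTE vi) Yout // inE => /orP[AZ|AZ].
      by move: BZ; rewrite (cZ _ _ _ BA AZ).
    have Di : ((v |: i) :\ v = i :\ v)%SET.
      by apply/setP => w; rewrite !inE; case: eqVneq.
    apply/MP; split.
    + by move=> k u; rewrite !inE /= nc.
    + by rewrite bases_north.
    + move=> k; rewrite !inE bases_north => /orP[/eqP[->]|/An//].
      by split => //; rewrite /W !inE eqxx.
    + have D k : north k \in (north (v |: i) |: A)%SET -> (k :\ v = i :\ v)%SET.
        rewrite !inE => /orP[/eqP[->] //|kA].
        exact: Au.
      by move=> k l /D -> /D ->.
  - move=> _ _ _ _ [i [B [vi _ _ ->]]] [i' [B' [vi' _ -> _]]]; rewrite !inE negb_or.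
    apply/andP; split; last by apply/imsetP => -[].
    by apply/eqP => -[e]; move: vi'; rewrite -e !inE eqxx.
(* The two cones are now joined by the edge between their apexes, whose link is
   the intersection of Z i and Z (v |: i), a cone with apex c. *)
have M'Z : homotopy_equivalent R (realization R M') (realization R (fan X Z)).
  apply: (@collapse _ _ _ _ (fun tau b => exists i : I,
    [/\ v \notin i, tau = [set north i; north (v |: i)]%SET & b = base c])) => //.
  - exact: complex_avoid E2.
  - move=> A; split.
      move=> /fanP[nc AX An Au]; split.
        apply/M'P; split; last by move=> i vi /An[].
        apply/MP; split => //; last by move=> i j iA jA; rewrite (Au i j).
        move=> i /An[sA AZ]; split => //; rewrite /W; case: ifPn => // vi.
        by rewrite Yout // inE AZ.
      move=> _ _ [i [vi -> _]]; rewrite finset.subUset !finset.sub1set.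
      apply/negP => /andP[iA iA']; move: vi.
      by rewrite (Au _ _ iA iA') !inE eqxx.
    move=> [/M'P[/MP[nc AX An Au] AZ] nA].
    have npair (i : I) : v \notin i -> north i \in A -> north (v |: i)%SET \in A -> False.
      move=> vi iA iA'.
      have : ~~ ([set north i; north (v |: i)]%SET \subset A).
        by apply: (nA _ (base c)); exists i.
      by rewrite finset.subUset !finset.sub1set iA iA'.
    apply/fanP; split => //.
      move=> i iA; have [sA] := An i iA; rewrite /W; case: ifPn => // vi _.
      by split => //; exact: AZ.
    move=> i j iA jA; have := Au i j iA jA.
    have [vi|vi] := boolP (v \in i); have [vj|vj] := boolP (v \in j).
    + by move=> e; rewrite -(finset.setD1K vi) e finset.setD1K.
    + rewrite (D1 j) // => e; exfalso; apply: (npair j) => //.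
      by rewrite -e finset.setD1K.
    + rewrite (D1 i) // => e; exfalso; apply: (npair i) => //.
      by rewrite e finset.setD1K.
    + by rewrite !D1.
  - by move=> _ _ [i [_ -> _]]; apply/set0Pn; exists (north i); rewrite !inE eqxx.
  - move=> _ _ [i [vi -> ->]] A /M'P[/MP[nc AX An Au] AZ].
    rewrite finset.subUset !finset.sub1set => /andP[iA iA'].
    have AZi := AZ i vi iA; have [sA AWi'] := An _ iA'.
    have AZi' : bases A \in Z (v |: i)%SET by move: AWi'; rewrite /W !inE eqxx.
    have [cAi cAi'] := apexZ i _ vi AZi AZi'.
    have in_pair (k : I) : north k \in A -> if v \in k then k = (v |: i)%SET else k = i.
      move=> kA; have := Au k i kA iA; rewrite (D1 i vi); case: ifPn => vk.
        by move=> <-; rewrite finset.setD1K.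
      by rewrite D1.
    apply/M'P; split; last first.
      move=> k vk; rewrite !inE bases_base => /orP[/eqP //|kA].
      by have := in_pair k kA; rewrite (negbTE vk) => ->.
    apply/MP; split.
    + by move=> k u; rewrite !inE /= nc.
    + by rewrite bases_base; exact: (fintype.subsetP (ZX i)).
    + move=> k; rewrite !inE bases_base => /orP[/eqP //|kA].
      have [_ _] := An k kA; split => //; rewrite /W.
      have := in_pair k kA; case: ifP => vk -> //.
      by rewrite Yout // inE cAi.
    + by move=> k l; rewrite !inE => /orP[/eqP //|kA] /orP[/eqP //|lA]; exact: Au.
  - by move=> _ _ _ _ [i [_ _ ->]] [i' [_ -> _]]; rewrite !inE.
apply: homotopy_equivalent_trans (homotopy_equivalent_sym MY) _.
exact: homotopy_equivalent_trans MM' M'Z.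
Qed.

End split.

(** * Separating the cones *)

Section shadow.
Variables (U I : finType).
Implicit Types (u : U) (i k : I) (A B : {set fan_vertex U I}).

(** The simplex of the base complex that is left when copies are identified with
    their originals. *)
Definition shadow A : {set U} :=
  [set u | (base u \in A) || [exists i, copy i u \in A]]%SET.

Definition touches A i := north i \in A \/ exists u, copy i u \in A.

Lemma shadowS A B : A \subset B -> shadow A \subset shadow B.
Proof.
move=> /fintype.subsetP AB; apply/fintype.subsetP => u; rewrite !inE.
move=> /orP[/AB -> //|/existsP[i /AB iB]].
by apply/orP; right; apply/existsP; exists i.
Qed.

Lemma touchesS A B i : A \subset B -> touches A i -> touches B i.
Proof.
by move=> /fintype.subsetP AB [/AB|[u /AB uB]]; [left|right; exists u].
Qed.

Lemma shadow_base u A : shadow (base u |: A)%SET = (u |: shadow A)%SET.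
Proof.
apply/setP => w; rewrite !inE -orbA; congr (_ || (_ || _)).
by apply: eq_existsb => k; rewrite !inE.
Qed.

Lemma shadow_copy i u A : shadow (copy i u |: A)%SET = (u |: shadow A)%SET.
Proof.
apply/setP => w; rewrite !inE /=; have [->|wu] := eqVneq w u.
  by rewrite /= orbC; apply/orP; left; apply/existsP; exists i; rewrite !inE eqxx.
congr orb; apply: eq_existsb => k; rewrite !inE orb_idl // => /eqP[_ e].
by rewrite e eqxx in wu.
Qed.

Lemma shadow_south A : shadow (south |: A)%SET = shadow A.
Proof.
by apply/setP => w; rewrite !inE /=; congr orb; apply: eq_existsb => k; rewrite !inE.
Qed.

Lemma touches_base u A i : touches (base u |: A)%SET i -> touches A i.
Proof.
by move=> [|[w]]; rewrite !inE; [left|right; exists w].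
Qed.

Lemma touches_south A i : touches (south |: A)%SET i -> touches A i.
Proof.
by move=> [|[w]]; rewrite !inE; [left|right; exists w].
Qed.

Lemma touches_copy k u A i : touches (copy k u |: A)%SET i -> i = k \/ touches A i.
Proof.
move=> [|[w]]; rewrite !inE; first by right; left.
by move=> /orP[/eqP[-> _]|wA]; [left|right; right; exists w].
Qed.

Lemma copies_base u A i : copies i (base u |: A)%SET = copies i A.
Proof.
by apply/setP => w; rewrite !inE.
Qed.

Lemma copies_south A i : copies i (south |: A)%SET = copies i A.
Proof.
by apply/setP => w; rewrite !inE.
Qed.

Lemma copies_copy u A i : copies i (copy i u |: A)%SET = (u |: copies i A)%SET.
Proof.
apply/setP => w; rewrite !inE; congr orb.
by apply/eqP/eqP => [[->//]|->].
Qed.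

Lemma mem_shadow u i A : copy i u \in A -> u \in shadow A.
Proof.
by move=> uA; rewrite inE; apply/orP; right; apply/existsP; exists i.
Qed.

Lemma shadow_idl u A : u \in shadow A -> (u |: shadow A)%SET = shadow A.
Proof.
by move=> uA; apply/finset.setUidPr; rewrite finset.sub1set.
Qed.

Lemma copies_shadow i A : copies i A \subset shadow A.
Proof.
by apply/fintype.subsetP => u; rewrite inE; exact: mem_shadow.
Qed.

End shadow.

Section bouquet.
Variables (R : realType) (U I : finType).

(** The wedge, at the vertex [south], of the suspensions of disjoint copies of the
    [Y i]. *)
Definition bouquet (Y : I -> {set {set U}}) : {set {set fan_vertex U I}} :=
  (\bigcup_i suspension_complex south (north i) (relabel_complex (copy i) (Y i)))%SET.

Lemma copy_inj i : injective (copy i : U -> fan_vertex U I).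
Proof. by move=> u v []. Qed.

Lemma base_inj : injective (base : U -> fan_vertex U I).
Proof. by move=> u v []. Qed.

(** Each cone is moved from the base complex to a copy of its own base. After that
    the base complex is attached to the rest only through the apex [south] of
    its cone, and the cone is contracted. *)
Lemma fan_bouquet (X : {set {set U}}) (Y : I -> {set {set U}}) :
  complex X -> (forall i, complex (Y i)) -> (forall i, Y i \subset X) ->
  (exists i, finset.set0 \in Y i) ->
  homotopy_equivalent R (realization R (fan X Y)) (realization R (bouquet Y)).
Proof.
move=> cX cY YX [i0 Y0].
(* In M a copy can be used along with its original or in place of it, both in
   the cone over X and in the cone over Y i. *)
pose M : {set {set fan_vertex U I}} := [set A : {set fan_vertex U I} | `[<
    [/\ shadow A \in X, forall i j, touches A i -> touches A j -> i = j,
        forall i, touches A i -> copies i A \in Y i &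
        forall i, north i \in A -> south \notin A /\ shadow A \in Y i] >]]%SET.
have MP A : A \in M <->
    [/\ shadow A \in X, forall i j, touches A i -> touches A j -> i = j,
        forall i, touches A i -> copies i A \in Y i &
        forall i, north i \in A -> south \notin A /\ shadow A \in Y i].
  by rewrite inE; split => /asboolP.
have cM : complex M.
  move=> A B AB /MP[BX Bt BY Bn]; have AB' := fintype.subsetP AB.
  apply/MP; split.
  - exact: cX (shadowS AB) BX.
  - by move=> i j /(touchesS AB) ti /(touchesS AB) tj; exact: Bt.
  - move=> i /(touchesS AB) /BY; apply: cY; exact: preimsetS.
  - move=> i /AB' /Bn[sB BYi]; split; first by apply: contra sB; exact: AB'.
    exact: cY (shadowS AB) BYi.
(* Every copy is dominated by its original. *)
have Mfan : homotopy_equivalent R (realization R M) (realization R (fan X Y)).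
  apply: (@collapse _ _ _ _ (fun tau c => exists i u,
    tau = [set copy i u]%SET /\ c = base u)) => //.
  - move=> A; split.
      move=> /fanP[nc AX An Au].
      have shA : shadow A = bases A.
        apply/setP => u; rewrite !inE orb_idr // => /existsP[i].
        by rewrite (negbTE (nc i u)).
      have tA i : touches A i -> north i \in A.
        by move=> [//|[u]]; rewrite (negbTE (nc i u)).
      split; last by move=> _ _ [i [u [-> _]]]; rewrite finset.sub1set nc.
      apply/MP; split.
      - by rewrite shA.
      - by move=> i j /tA ti /tA tj; exact: Au.
      - move=> i /tA /An[_]; apply: cY; apply/fintype.subsetP => u.
        by rewrite inE (negbTE (nc i u)).
      - by move=> i /An; rewrite shA.
    move=> [/MP[AX At AY An] nA].
    have nc i u : copy i u \notin A.
      by rewrite -finset.sub1set; apply: (nA _ (base u)); exists i, u.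
    have shA : shadow A = bases A.
      apply/setP => u; rewrite !inE orb_idr // => /existsP[i].
      by rewrite (negbTE (nc i u)).
    apply/fanP; split => //.
    - by rewrite -shA.
    - by move=> i /An; rewrite shA.
    - by move=> i j iA jA; apply: At; left.
  - by move=> _ _ [i [u [-> _]]]; apply/set0Pn; exists (copy i u); rewrite inE.
  - move=> _ _ [i [u [-> ->]]] A /MP[AX At AY An]; rewrite finset.sub1set => uA.
    have shA := shadow_idl (mem_shadow uA).
    apply/MP; rewrite shadow_base shA; split => //.
    + by move=> k l /touches_base tk /touches_base tl; exact: At.
    + by move=> k /touches_base; rewrite copies_base; exact: AY.
    + by move=> k; rewrite !inE; exact: An.
  - by move=> _ _ _ _ [i [u [_ ->]]] [i' [u' [-> _]]]; rewrite inE.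
(* The edges from an apex north i to the base complex are dominated by copies,
   so the cone at north i can be restricted to copies. *)
pose M' : {set {set fan_vertex U I}} := [set A in M | `[< forall i u,
  north i \in A -> base u \notin A >]]%SET.
have M'P A : A \in M' <-> A \in M /\ (forall i u,
  north i \in A -> base u \notin A).
  by rewrite inE; split => [/andP[? /asboolP ?]|[? ?]] //; apply/andP; split => //; apply/asboolP.
pose P2 (tau : {set fan_vertex U I}) (c : fan_vertex U I) := exists i u,
  tau = [set north i; base u]%SET /\ c = copy i u.
have E2 A : A \in M' <-> A \in M /\ forall tau c, P2 tau c -> ~~ (tau \subset A).
  split.
    move=> /M'P[AM nA]; split => // _ _ [i [u [-> _]]].
    rewrite finset.subUset !finset.sub1set; apply/negP => /andP[iA].
    by rewrite (negbTE (nA i u iA)).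
  move=> [AM nA]; apply/M'P; split => // i u iA; apply/negP => uA.
  have : ~~ ([set north i; base u]%SET \subset A).
    by apply: (nA _ (copy i u)); exists i, u.
  by rewrite finset.subUset !finset.sub1set iA uA.
have MM' : homotopy_equivalent R (realization R M) (realization R M').
  apply: (@collapse _ _ _ _ P2) => //.
  - by move=> _ _ [i [u [-> _]]]; apply/set0Pn; exists (north i); rewrite !inE eqxx.
  - move=> _ _ [i [u [-> ->]]] A /MP[AX At AY An].
    rewrite finset.subUset !finset.sub1set => /andP[iA uA].
    have uS : u \in shadow A by rewrite inE uA.
    have ti : touches A i by left.
    have tA k : touches (copy i u |: A)%SET k -> k = i.
      by move=> /touches_copy[//|tk]; exact: At.
    have [sA shY] := An i iA.
    apply/MP; rewrite shadow_copy (shadow_idl uS); split => //.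
    + by move=> k l /tA -> /tA ->.
    + move=> k /tA ->; rewrite copies_copy; apply: cY shY.
      by rewrite finset.subUset finset.sub1set uS copies_shadow.
    + by move=> k; rewrite !inE; exact: An.
  - by move=> _ _ _ _ [i [u [_ ->]]] [i' [u' [-> _]]]; rewrite !inE.
have bouquetP A : A \in bouquet Y <-> exists i,
    [/\ forall w, w \in A -> [\/ w = south, w = north i | exists u, w = copy i u],
        south \in A -> north i \in A -> False & copies i A \in Y i].
  split.
    move=> /bigcupP[i _ /suspension_relabelP Ai]; exists i.
    by apply: Ai => //; exact: copy_inj.
  move=> [i Ai]; apply/bigcupP; exists i => //; apply/suspension_relabelP => //.
  exact: copy_inj.
(* No simplex has both a base vertex and an apex north i any more, so the base
   vertices are dominated by south. *)
have M'B : homotopy_equivalent R (realization R M') (realization R (bouquet Y)).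
  apply: (@collapse _ _ _ _ (fun tau c => exists u : U,
    tau = [set base u]%SET /\ c = south)) => //.
  - exact: complex_avoid E2.
  - move=> A; split.
      move=> /bouquetP[i [Aw sA AY]].
      have nb u : base u \notin A by apply/negP => /Aw[//|//|[]].
      have shA : shadow A = copies i A.
        apply/setP => u; rewrite !inE (negbTE (nb u)) /=.
        apply/existsP/idP => [[k kA]|uA]; last by exists i.
        by case: (Aw _ kA) => // -[w [ki uw]]; rewrite ki uw in kA *; rewrite -uw in kA *.
      have tA k : touches A k -> k = i.
        by move=> [/Aw[//|[->//]|[]//]|[u /Aw[//|//|[w [->]]]]].
      split; last by move=> _ _ [u [-> _]]; rewrite finset.sub1set nb.
      apply/M'P; split => //; apply/MP; rewrite shA; split.
      + exact: (fintype.subsetP (YX i)).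
      + by move=> k l /tA -> /tA ->.
      + by move=> k /tA ->.
      + move=> k kA; have ki : k = i by apply: tA; left.
        by rewrite ki in kA *; split => //; apply/negP => /sA; apply.
    move=> [/M'P[/MP[AX At AY An] nA] nb].
    have nb' u : base u \notin A.
      by rewrite -finset.sub1set; apply: (nb _ south); exists u.
    apply/bouquetP.
    have [[i ti]|nt] := pselect (exists i, touches A i).
      exists i; split; last exact: AY.
      + move=> [[[k|u]|[k u]]|] wA; last exact: Or31.
        * by apply: Or32; rewrite (At i k) //; left.
        * by move: wA; rewrite (negbTE (nb' u)).
        * by apply: Or33; exists u; rewrite (At i k) //; right; exists u.
      + by move=> sA /An[]; rewrite sA.
    (* Such a simplex is empty or consists of south, which lies in every piece that
       is present, for instance in the one with index i0. *)
    exists i0; split.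
    + move=> [[[k|u]|[k u]]|] wA; last exact: Or31.
      * by exfalso; apply: nt; exists k; left.
      * by move: wA; rewrite (negbTE (nb' u)).
      * by exfalso; apply: nt; exists k; right; exists u.
    + by move=> _ iA; apply: nt; exists i0; left.
    + apply: cY Y0; apply/fintype.subsetP => u; rewrite inE => uA.
      by exfalso; apply: nt; exists i0; right; exists u.
  - by move=> _ _ [u [-> _]]; apply/set0Pn; exists (base u); rewrite inE.
  - move=> _ _ [u [-> ->]] A /M'P[/MP[AX At AY An] nA]; rewrite finset.sub1set => uA.
    have nN i : north i \notin A by apply/negP => iA; move: (nA i u iA); rewrite uA.
    apply/M'P; split; last by move=> i w; rewrite !inE /= (negbTE (nN i)).
    apply/MP; rewrite shadow_south; split => //.
    + by move=> k l /touches_south tk /touches_south tl; exact: At.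
    + by move=> k /touches_south; rewrite copies_south; exact: AY.
    + by move=> i; rewrite !inE /= (negbTE (nN i)).
  - by move=> _ _ _ _ [u [_ ->]] [u' [-> _]]; rewrite inE.
apply: homotopy_equivalent_trans (homotopy_equivalent_sym Mfan) _.
exact: homotopy_equivalent_trans MM' M'B.
Qed.

End bouquet.

(** * The independence complex of a lexicographic product *)

Lemma indepP (G : sgraph) (A : {set G}) :
  A \in indep_complex G <-> forall x y, x \in A -> y \in A -> ~~ edge x y.
Proof.
rewrite inE; split.
  by move=> /forall_inP iA x y xA yA; have /forall_inP := iA x xA; apply.
move=> iA; apply/forall_inP => x xA; apply/forall_inP => y yA; exact: iA.
Qed.

Lemma complex_indep (G : sgraph) : complex (indep_complex G).
Proof. by move=> A B; exact: indep_complexS. Qed.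

Section lexicographic.
Variables (R : realType) (G H : sgraph) (x0 : H).

Let U : finType := (G * H)%type.
Let X : {set {set U}} := indep_complex (lex_prod G H).

(** For [T] empty this is the join of the link of [sigma] with the powers of
    F_0(H), for [T] everything and [sigma] empty it is the whole complex. *)
Definition partial_link (T sigma : {set G}) : {set {set U}} :=
  [set A : {set U} | `[< [/\ A \in X,
      ([set x.1 | x in A] :|: sigma)%SET \in indep_complex G &
      forall x, x \in A -> [\/ x.1 \in T, x.1 \in sigma | x.2 = x0]] >]]%SET.

Lemma partial_linkP T sigma A : A \in partial_link T sigma <->
  [/\ A \in X, ([set x.1 | x in A] :|: sigma)%SET \in indep_complex G &
      forall x, x \in A -> [\/ x.1 \in T, x.1 \in sigma | x.2 = x0]].
Proof. by rewrite inE; split => /asboolP. Qed.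

Lemma complex_partial_link T sigma : complex (partial_link T sigma).
Proof.
move=> A B AB /partial_linkP[BX Bs Bx]; have AB' := fintype.subsetP AB.
apply/partial_linkP; split.
- exact: (complex_indep (G := lex_prod G H)) AB BX.
- by apply: complex_indep Bs; apply: finset.setSU; exact: imsetS.
- by move=> x /AB' /Bx.
Qed.

(** The index [sigma] is in use only when all its vertices have been treated, that
    is, taken out of [T]. Before that its base has no simplex, not even the
    empty one, and the fan has no apex for it. *)
Definition stage (T sigma : {set G}) : {set {set U}} :=
  if (sigma :&: T == finset.set0)%SET then partial_link T sigma else finset.set0.

Lemma complex_stage T sigma : complex (stage T sigma).
Proof.
rewrite /stage; case: ifP => _; first exact: complex_partial_link.
by move=> A B _; rewrite inE.
Qed.

Lemma stage_sub T sigma : stage T sigma \subset X.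
Proof.
rewrite /stage; case: ifP => _; last exact: finset.sub0set.
by apply/fintype.subsetP => A /partial_linkP[].
Qed.

Lemma fst_indep A : A \in X -> [set x.1 | x in A]%SET \in indep_complex G.
Proof.
move=> /(indepP (G := lex_prod G H)) iA; apply/indepP => _ _ /imsetP[x xA ->] /imsetP[y yA ->].
have : ~~ lex_rel x y := iA x y xA yA.
by rewrite /lex_rel negb_or => /andP[].
Qed.

(** The parts of [partial_link T i] are given by whether its simplices have at most
    the vertex (v, x0) over [v], or are compatible with adding [v] to [i]. In
    the intersection both hold, so (v, x0) can be added to every simplex. *)
Lemma stage_step (T : {set G}) (v : G) : v \in T ->
  homotopy_equivalent R (realization R (fan X (stage T)))
                        (realization R (fan X (stage (T :\ v)%SET))).
Proof.
move=> vT; apply: (@fan_split R U G X _ _ v (v, x0)).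
- exact: (complex_indep (G := lex_prod G H)).
- by move=> i; exact: complex_stage.
- by move=> i; exact: stage_sub.
- move=> i vi.
  have dE : (i :&: (T :\ v) = i :&: T)%SET.
    apply/setP => w; rewrite !inE; have [->|//] := eqVneq w v.
    by rewrite (negbTE vi).
  have dE' : ((v |: i) :&: (T :\ v) = i :&: T)%SET.
    by rewrite -dE; apply/setP => w; rewrite !inE; case: eqVneq; rewrite ?andbF.
  rewrite /stage dE dE'; case: ifP => _; last by rewrite finset.setU0.
  apply/setP => A; rewrite finset.in_setU; apply/idP/orP.
    move=> /partial_linkP[AX Ai Ax].
    have [[h [vhA hx0]]|nA] := pselect (exists h, (v, h) \in A /\ h <> x0).
      right; apply/partial_linkP; split => //.
        rewrite (_ : (_ :|: (v |: i))%SET = ([set x.1 | x in A] :|: i)%SET) //.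
        rewrite finset.setUA; congr (_ :|: i)%SET.
        rewrite finset.setUC; apply/finset.setUidPr; rewrite finset.sub1set.
        by apply/imsetP; exists (v, h).
      move=> x /Ax[xT|xi|xx]; last by apply: Or33.
        have [xv|xv] := eqVneq x.1 v; first by apply: Or32; rewrite xv !inE eqxx.
        by apply: Or31; rewrite !inE xv.
      by apply: Or32; rewrite !inE xi orbT.
    left; apply/partial_linkP; split => // x xA; case: (Ax x xA) => [xT|xi|xx].
    - have [xv|xv] := eqVneq x.1 v; last by apply: Or31; rewrite !inE xv.
      apply: Or33; apply: contrapT => xx; apply: nA; exists x.2; split => //.
      by rewrite -xv -surjective_pairing.
    - exact: Or32.
    - exact: Or33.
  move=> [|] /partial_linkP[AX Ai Ax]; apply/partial_linkP; split => //.
  + move=> x /Ax[|xi|xx]; [rewrite !inE => /andP[_ xT]; exact: Or31|exact: Or32|exact: Or33].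
  + apply: complex_indep Ai; apply: finset.setUS; exact: subsetU1.
  + move=> x /Ax[|xi|xx]; [rewrite !inE => /andP[_ xT]; exact: Or31| |exact: Or33].
    move: xi; rewrite !inE => /orP[/eqP ->|xi]; [exact: Or31|exact: Or32].
- move=> i vi; rewrite /stage ifF //; apply/negbTE.
  by apply/set0Pn; exists v; rewrite inE vi vT.
- move=> i A vi; rewrite /stage; case: ifP => d1; last by rewrite inE.
  case: ifP => d2; last by rewrite [in X in _ -> X -> _]inE.
  move=> /partial_linkP[AX Ai Ax] /partial_linkP[_ Avi Avx].
  have fstA : ([set x.1 | x in (v, x0) |: A] :|: (v |: i) =
               [set x.1 | x in A] :|: (v |: i))%SET.
    rewrite imsetU1 /=; apply/setP => w; rewrite !finset.in_setU !finset.in_set1.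
    by case: (w == v); rewrite /= ?orbT.
  have vAX : ((v, x0) |: A)%SET \in X.
    apply/(indepP (G := lex_prod G H)) => x y.
    have Ak (z w : U) : z.1 \in ([set x.1 | x in A] :|: (v |: i))%SET ->
        w.1 \in ([set x.1 | x in A] :|: (v |: i))%SET -> ~~ edge z.1 w.1.
      by move=> ? ?; move/indepP: Avi; apply.
    have inA (z : U) : z \in A -> z.1 \in ([set x.1 | x in A] :|: (v |: i))%SET.
      by move=> zA; rewrite inE imset_f.
    have inv : v \in ([set x.1 | x in A] :|: (v |: i))%SET by rewrite !inE eqxx orbT.
    have vx0 (z : U) : z \in A -> z.1 = v -> z.2 = x0.
      move=> zA zv; case: (Ax z zA) => //; rewrite zv; first by rewrite !inE eqxx.
      by rewrite (negbTE vi).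
    rewrite [x \in _]inE [y \in _]inE !finset.in_set1 /= /lex_rel.
    move=> /orP[/eqP ->|xA] /orP[/eqP ->|yA] /=.
    + by rewrite !edge_irr andbF.
    + rewrite negb_or (Ak (v, x0)) // ?inA // andbT negb_and.
      have [e|//] := eqVneq v y.1; by rewrite (vx0 y) ?edge_irr.
    + rewrite negb_or (Ak x (v, x0)) // ?inA // andbT negb_and.
      have [e|//] := eqVneq x.1 v; by rewrite (vx0 x) ?edge_irr.
    + by move/(indepP (G := lex_prod G H)): AX => /(_ x y xA yA).
  split; apply/partial_linkP; split => //.
  + apply: complex_indep Avi; rewrite -fstA; apply: finset.setUS; exact: subsetU1.
  + by move=> x; rewrite finset.in_setU1 => /orP[/eqP ->|/Ax //]; exact: Or33.
  + by rewrite fstA.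
  + by move=> x; rewrite finset.in_setU1 => /orP[/eqP ->|/Avx //]; exact: Or33.
Qed.

Lemma stages (T : {set G}) :
  homotopy_equivalent R (realization R (fan X (stage T)))
                        (realization R (fan X (stage finset.set0))).
Proof.
have [n] := ubnP #|T|; elim: n T => // n IHn T; rewrite ltnS => Tn.
have [->|/set0Pn[v vT]] := eqVneq T finset.set0.
  exact: homotopy_equivalent_refl.
apply: homotopy_equivalent_trans (stage_step vT) _.
by apply: IHn; apply: leq_trans Tn; rewrite [leqRHS](cardsD1 v) vT.
Qed.

Lemma suspension_fan :
  homotopy_equivalent R (suspension R (realization R X))
                        (realization R (fan X (stage [set: G]%SET))).
Proof.
have cX : complex X by exact: (complex_indep (G := lex_prod G H)).
have e1 := embedding_relabel (@base_inj U {set G}) (embedding_realization R cX).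
have [|||F e2 _] := @embedding_suspension R _ south (north finset.set0) isT _ _ _ _ _ _ e1.
- by apply: complex_relabel => //; exact: base_inj.
- by apply: relabel_complex0; exact: (indep_complex0 (lex_prod G H)).
- by move=> _ /imsetP[B _ ->]; split; apply/imsetP => -[].
apply: homotopy_equivalent_trans (embedding_equiv e2) _.
rewrite (_ : suspension_complex _ _ _ = fan X (stage [set: G]%SET)).
  exact: homotopy_equivalent_refl.
have stX A : A \in stage [set: G]%SET finset.set0 <-> A \in X.
  rewrite /stage ifT; last by rewrite finset.set0I.
  split => [/partial_linkP[]//|AX]; apply/partial_linkP; split => //.
    by rewrite finset.setU0 fst_indep.
  by move=> x _; apply: Or31; rewrite inE.
have st0 sigma A : A \in stage [set: G]%SET sigma -> sigma = finset.set0.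
  rewrite /stage; case: ifPn => [|_]; last by rewrite inE.
  by rewrite finset.setIT => /eqP.
apply/setP => A; apply/idP/idP.
  move=> /suspension_relabelP[||||Aw sA AX] //; first exact: base_inj.
  have nA i : north i \in A -> i = finset.set0 by move=> /Aw[//|[//]|[u]].
  apply/fanP; split => //.
  - by move=> i u; apply/negP => /Aw[//|//|[]].
  - move=> i /[dup] /nA -> iA; split; first by apply/negP => /sA; apply.
    exact/stX.
  - by move=> i j /nA -> /nA ->.
move=> /fanP[nc AX An Au]; apply/suspension_relabelP => //; first exact: base_inj.
split => //.
- move=> [[[i|u]|[i u]]|] wA; last exact: Or31.
  + by have [_ /st0 ->] := An _ wA; exact: Or32.
  + by apply: Or33; exists u.
  + by move: (nc i u); rewrite wA.
- by move=> sA /An[]; rewrite sA.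
Qed.

(** The join of copies of F_0(H) indexed by [sigma]. *)
Definition power_complex (sigma : {set G}) : {set {set U}} :=
  [set A : {set U} | `[< (forall x, x \in A -> x.1 \in sigma) /\
     forall x y, x \in A -> y \in A -> x.1 = y.1 -> ~~ edge x.2 y.2 >]]%SET.

Lemma power_complexP sigma A : A \in power_complex sigma <->
  (forall x, x \in A -> x.1 \in sigma) /\
  forall x y, x \in A -> y \in A -> x.1 = y.1 -> ~~ edge x.2 y.2.
Proof. by rewrite inE; split => /asboolP. Qed.

Lemma complex_power sigma : complex (power_complex sigma).
Proof.
move=> A B /fintype.subsetP AB /power_complexP[Bs Be]; apply/power_complexP.
by split => [x /AB|x y /AB xA /AB yA]; [exact: Bs|exact: Be].
Qed.

Lemma power_complex0 sigma : finset.set0 \in power_complex sigma.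
Proof. by apply/power_complexP; split => [x|x y]; rewrite inE. Qed.

Lemma power_embedding (k : nat) (sigma : {set G}) : #|sigma| = k ->
  exists F : join_power R (realization R (indep_complex H)) k -> coords R U,
    embedding (power_complex sigma) F.
Proof.
elim: k sigma => [|k IHk] sigma sk.
  have -> : sigma = finset.set0 by apply/eqP; rewrite -cards_eq0 sk.
  exists (fun x : void => match x with end); apply: embedding_void => [[]|].
  apply/setP => A; rewrite finset.in_set1; apply/idP/eqP.
    move=> /power_complexP[A0 _]; apply/setP => x; rewrite [RHS]inE.
    by apply/negP => /A0; rewrite inE.
  by move=> ->; exact: power_complex0.
have /set0Pn[v vs] : sigma != finset.set0 by rewrite -card_gt0 sk.
have [F Fe] : exists F : join_power R (realization R (indep_complex H)) k -> coords R U,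
    embedding (power_complex (sigma :\ v)%SET) F.
  by apply: IHk; move: sk; rewrite (cardsD1 v) vs => -[].
have ji : injective (fun h : H => (v, h) : U) by move=> h h' [].
have cH := @complex_indep H.
have e1 := embedding_relabel ji (embedding_realization R cH).
have [|||||| F' Fe'] := @embedding_join R U _ _ _ _ [set x : U | x.1 == v]%SET _ _ _ _ _ _ _ _ e1 Fe.
- exact: complex_relabel.
- exact: complex_power.
- by apply: relabel_complex0; exact: indep_complex0.
- exact: power_complex0.
- move=> _ /imsetP[B _ ->]; apply/fintype.subsetP => _ /imsetP[h _ ->].
  by rewrite inE.
- move=> B /power_complexP[Bs _]; apply/fintype.subsetP => x /Bs.
  by rewrite !inE => /andP[].
exists F'; rewrite (_ : power_complex sigma = join_complex
  (relabel_complex (fun h : H => (v, h) : U) (indep_complex H))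
  (power_complex (sigma :\ v)%SET)) //.
apply/setP => A; apply/idP/imset2P.
  move=> /power_complexP[As Ae].
  exists ((fun h : H => (v, h) : U) @: [set h | (v, h) \in A])%SET
         [set x in A | x.1 != v]%SET.
  - apply/imset_f/indepP => h h'; rewrite !inE => hA hA'.
    exact: (Ae (v, h) (v, h')).
  - apply/power_complexP; split => [x|x y]; rewrite !inE.
      by move=> /andP[/As -> ->].
    by move=> /andP[xA _] /andP[yA _]; exact: Ae.
  - apply/setP => x; rewrite finset.in_setU; apply/idP/orP.
      move=> xA; have [xv|xv] := eqVneq x.1 v; last by right; rewrite inE xA.
      left; apply/imsetP; exists x.2; last by rewrite -xv -surjective_pairing.
      by rewrite inE -xv -surjective_pairing.
    by move=> [/imsetP[h]|]; rewrite inE; [move=> hA ->|case/andP].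
move=> [_ B /imsetP[C /indepP iC ->] /power_complexP[Bs Be] ->].
have Cv x : x \in ((fun h : H => (v, h) : U) @: C)%SET -> x.1 = v /\ x.2 \in C.
  by move=> /imsetP[h hC ->].
have Bv x : x \in B -> x.1 != v by move=> /Bs; rewrite !inE => /andP[].
apply/power_complexP; split => [x|x y].
  rewrite finset.in_setU => /orP[/Cv[-> _] //|/Bs].
  by rewrite !inE => /andP[].
rewrite !finset.in_setU => /orP[/Cv[xv xC]|xB] /orP[/Cv[yv yC]|yB] xy.
- exact: iC.
- by have := Bv _ yB; rewrite -xy xv eqxx.
- by have := Bv _ xB; rewrite xy yv eqxx.
- exact: Be.
Qed.

(** * Links as joins *)

Notation link_graph sigma :=
  (del_vertices (\bigcup_(v in sigma) closed_nbhd v)%SET).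

Definition at_x0 (sigma : {set G}) (v : link_graph sigma) : U := (val v, x0).

(** A simplex is cut into its vertices over [sigma] and the rest; the rest has
    second coordinate x0, and its projection avoids the closed neighbourhoods
    of [sigma] because its union with [sigma] is independent. *)
Lemma link_join (sigma : {set G}) : sigma \in indep_complex G ->
  partial_link finset.set0 sigma = join_complex
    (relabel_complex (@at_x0 sigma)
       (indep_complex (link_graph sigma)))
    (power_complex sigma).
Proof.
move=> /indepP is_; apply/setP => A; apply/idP/imset2P.
  move=> /partial_linkP[/(indepP (G := lex_prod G H)) AX /indepP As Ax].
  exists (@at_x0 sigma @:
            [set v : link_graph sigma | (val v, x0) \in A])%SET
         [set x in A | x.1 \in sigma]%SET.
  - apply/imset_f/indepP => v w; rewrite !inE => vA wA.
    have : ~~ lex_rel (val v, x0) (val w, x0) := AX _ _ vA wA.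
    by rewrite /lex_rel negb_or => /andP[].
  - apply/power_complexP; split => [x|x y]; rewrite !inE; first by case/andP.
    move=> /andP[xA _] /andP[yA _] xy.
    have : ~~ lex_rel x y := AX _ _ xA yA.
    by rewrite /lex_rel negb_or xy eqxx => /andP[].
  - apply/setP => x; rewrite finset.in_setU; apply/idP/orP.
      move=> xA; have [xs|xs] := boolP (x.1 \in sigma).
        by right; rewrite inE xA.
      have xx : x.2 = x0.
        by case: (Ax x xA) => //; [rewrite inE|rewrite (negbTE xs)].
      have xN : x.1 \notin (\bigcup_(v in sigma) closed_nbhd v)%SET.
        apply/negP => /bigcupP[v vs]; rewrite inE => /orP[/eqP e|vx].
          by move: xs; rewrite e vs.
        have := As v x.1; rewrite !finset.in_setU vs orbT imset_f // vx.
        by move=> /(_ isT isT).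
      left; apply/imsetP; exists (exist _ x.1 xN).
        by rewrite inE /= -xx -surjective_pairing.
      by rewrite /at_x0 /= -xx -surjective_pairing.
    by move=> [/imsetP[v]|]; rewrite inE; [move=> vA ->|case/andP].
move=> [_ B /imsetP[C /indepP iC ->] /power_complexP[Bs Be] ->].
have Cv x : x \in (@at_x0 sigma @: C)%SET ->
    exists2 v : link_graph sigma, v \in C & x = (val v, x0).
  by move=> /imsetP[v vC ->]; exists v.
have far (v : link_graph sigma) w : w \in sigma -> val v != w /\ ~~ edge (val v) w.
  move=> ws; have := valP v; rewrite /= => vN.
  apply/andP; rewrite -negb_or; apply: contra vN => /orP vw.
  apply/bigcupP; exists w => //; rewrite inE.
  by case: vw => [->//|]; rewrite edge_sym => ->; rewrite orbT.
apply/partial_linkP; split.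
- apply/(indepP (G := lex_prod G H)) => x y.
  suff : x \in (@at_x0 sigma @: C :|: B)%SET ->
         y \in (@at_x0 sigma @: C :|: B)%SET ->
         ~~ lex_rel x y by [].
  rewrite !finset.in_setU /lex_rel negb_or negb_and.
  move=> /orP[/Cv[v vC ->]|xB] /orP[/Cv[w wC ->]|yB] /=.
  + by rewrite edge_irr orbT /=; exact: iC.
  + by have [-> ->] := far v y.1 (Bs _ yB).
  + have [vx] := far w x.1 (Bs _ xB).
    by rewrite eq_sym vx edge_sym => ->.
  + rewrite is_ ?Bs // andbT; have [e|//] := eqVneq x.1 y.1.
    exact: Be.
- apply/indepP => v w; rewrite !finset.in_setU.
  have E z : (z \in [set x.1 | x in @at_x0 sigma @: C :|: B]%SET)
      || (z \in sigma) -> z \in sigma \/ exists2 v : link_graph sigma, v \in C & z = val v.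
    move=> /orP[|zs]; last by left.
    move=> /imsetP[x]; rewrite finset.in_setU => /orP[/Cv[u uC ->]|/Bs xs] ->.
      by right; exists u.
    by left.
  move=> /E[vs|[v' vC ->]] /E[ws|[w' wC ->]].
  + exact: is_.
  + by rewrite edge_sym; case: (far w' v vs).
  + by case: (far v' w ws).
  + exact: iC.
- move=> x; rewrite finset.in_setU => /orP[/Cv[v vC ->]|/Bs]; first exact: Or33.
  exact: Or32.
Qed.

Lemma link_embedding (sigma : {set G}) : sigma \in indep_complex G ->
  exists F : join R (realization R (indep_complex (link_graph sigma)))
                  (join_power R (realization R (indep_complex H)) #|sigma|)
             -> coords R U,
    embedding (partial_link finset.set0 sigma) F.
Proof.
move=> sK.
have ji : injective (@at_x0 sigma).
  by move=> v w [] /val_inj.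
have cD := @complex_indep (link_graph sigma).
have e1 := embedding_relabel ji (embedding_realization R cD).
have [F Fe] := power_embedding (erefl #|sigma|).
have [|||||| F' Fe'] := @embedding_join R U _ _ _ _ [set x : U | x.1 \notin sigma]%SET _ _ _ _ _ _ _ _ e1 Fe.
- exact: complex_relabel.
- exact: complex_power.
- by apply: relabel_complex0; exact: indep_complex0.
- exact: power_complex0.
- move=> _ /imsetP[B _ ->]; apply/fintype.subsetP => _ /imsetP[v _ ->].
  rewrite inE /=; apply: contra (valP v) => vs.
  by apply/bigcupP; exists (val v) => //; rewrite inE eqxx.
- move=> B /power_complexP[Bs _]; apply/fintype.subsetP => x /Bs.
  by rewrite !inE negbK.
by exists F'; rewrite link_join.
Qed.

(** Indices that are not simplices of F_0(G) have no simplex in their stage, so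
    the bouquet over all subsets is the one over the simplices. *)
Lemma wedge_bouquet :
  homotopy_equivalent R
    (@wedge {sigma : {set G} | sigma \in indep_complex G}
       (fun sigma => suspension R
          (join R (realization R (indep_complex (link_graph (val sigma))))
             (join_power R (realization R (indep_complex H)) #|val sigma|)))
       (fun sigma => south_pole R _))
    (realization R (bouquet (stage finset.set0))).
Proof.
pose I : finType := {sigma : {set G} | sigma \in indep_complex G}.
pose K (i : I) : {set {set fan_vertex U {set G}}} :=
  suspension_complex south (north (val i))
    (relabel_complex (copy (val i)) (partial_link finset.set0 (val i))).
have exf (i : I) : exists F : suspension R
          (join R (realization R (indep_complex (link_graph (val i))))
             (join_power R (realization R (indep_complex H)) #|val i|)) ->
          coords R (fan_vertex U {set G}),
    embedding (K i) F /\ F (south_pole R _) = vtx R south.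
  have [F Fe] := link_embedding (valP i).
  have e1 := embedding_relabel (@copy_inj U {set G} (val i)) Fe.
  have [|||F' e2 sF] := @embedding_suspension R _ south (north (val i)) isT _ _ _ _ _ _ e1.
  - by apply: complex_relabel; [exact: copy_inj|exact: complex_partial_link].
  - apply: relabel_complex0; apply/partial_linkP; split.
    + exact: (indep_complex0 (lex_prod G H)).
    + by rewrite imset0 finset.set0U; exact: (valP i).
    + by move=> x; rewrite inE.
  - by move=> _ /imsetP[B _ ->]; split; apply/imsetP => -[].
  by exists F'.
pose f i := sval (cid (exf i)).
have fP i : embedding (K i) (f i) /\ f i (south_pole R _) = vtx R south.
  exact: svalP (cid (exf i)).
have disj (i j : I) A B : i != j -> A \in K i -> B \in K j -> A :&: B \subset [set south]%SET.
  move=> ij /suspension_relabelP[||||Aw _ _] //; first exact: copy_inj.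
  move=> /suspension_relabelP[||||Bw _ _] //; first exact: copy_inj.
  apply/fintype.subsetP => w; rewrite !inE => /andP[/Aw wA /Bw wB].
  apply/eqP; case: wA wB => [//|->|[u ->]] [//|[e]|[u' [e]]] //.
  - by move: ij; rewrite -val_eqE /= e eqxx.
  - by move: ij; rewrite -val_eqE /= e eqxx.
have := @embedding_wedge R _ south I _ (fun i => south_pole R _) K f
  (fun i => (fP i).1) (fun i => (fP i).2) disj.
move=> /embedding_equiv; rewrite (_ : (\bigcup_i K i)%SET = bouquet (stage finset.set0)) //.
apply/setP => A; apply/bigcupP/bigcupP => -[i _].
  by move=> Ai; exists (val i) => //; rewrite /stage finset.setI0 eqxx.
rewrite /stage finset.setI0 eqxx => Ai.
have [_ _ /partial_linkP[_ iS _]] : [/\ forall w, w \in A ->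
    [\/ w = south, w = north i | exists u, w = copy i u],
    south \in A -> north i \in A -> False &
    (copy i @^-1: A)%SET \in partial_link finset.set0 i].
  by apply/suspension_relabelP => //; exact: copy_inj.
have iK : i \in indep_complex G by apply: complex_indep iS; exact: finset.subsetUr.
by exists (exist _ i iK).
Qed.

End lexicographic.

Theorem theorem22 (R : realType) (G H : sgraph)
    (G_nonempty : (0 < #|G|)%N) (H_nonempty : (0 < #|H|)%N) :
  homotopy_equivalent R
    (suspension R (realization R (indep_complex (lex_prod G H))))
    (@wedge {sigma : {set G} | sigma \in indep_complex G}
       (fun sigma => suspension R
          (join R
             (realization R (indep_complex
                (del_vertices (\bigcup_(v in val sigma) closed_nbhd v)%SET)))
             (join_power R (realization R (indep_complex H)) #|val sigma|)))
       (fun sigma => south_pole R _)).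
Proof.
have /card_gt0P[x0 _] := H_nonempty.
apply: homotopy_equivalent_trans (suspension_fan R G x0) _.
apply: homotopy_equivalent_trans (stages R x0 [set: G]%SET) _.
apply: (homotopy_equivalent_trans _ (homotopy_equivalent_sym (@wedge_bouquet R G H x0))).
apply: fan_bouquet.
- exact: (complex_indep (G := lex_prod G H)).
- by move=> i; exact: complex_stage.
- by move=> i; exact: stage_sub.
- exists finset.set0; rewrite /stage finset.setI0 eqxx; apply/partial_linkP; split.
  + exact: (indep_complex0 (lex_prod G H)).
  + by rewrite imset0 finset.set0U; exact: indep_complex0.
  + by move=> x; rewrite inE.
Qed.
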